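(* Let $t\ge2$, let $n$ be a positive integer and let $\lambda$ be a partition of length at most $nt$. Then $\varphi_t\,\mathrm{sp}_\lambda=0$ unless $t\text{-core}(\lambda)$ is symplectic, in which case \[ \varphi_t\mathrm{sp}_\lambda=(-1)^{\varepsilon^{\mathrm{sp}}_{\lambda;nt}}\,\mathrm{sgn}(w_t(\lambda;nt))\,\mathrm{sp}_{\lambda^{(t-1)}}\prod_{r=0}^{\lfloor(t-3)/2\rfloor}\mathrm{rs}_{\lambda^{(r)},\lambda^{(t-r-2)}}\times\begin{cases}\mathrm{so}_{\lambda^{((t-2)/2)}}&t\text{ even},\\1&t\text{ odd},\end{cases} \] where \[ \varepsilon^{\mathrm{sp}}_{\lambda;nt}=\sum_{r=\lfloor t/2\rfloor}^{t-2}\binom{m_r(\lambda;nt)+1}{2}+\begin{cases}\binom{n+1}{2}+n\,\mathrm{rk}(t\text{-core}(\lambda))&t\text{ even},\\0&t\text{ odd}.\end{cases} \]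
   Context: $\Lambda$ is the ring of symmetric functions in countably many variables; $h_r$ are the complete homogeneous symmetric functions, with $h_0=1$ and $h_r=0$ for $r<0$. For $t\ge2$, $\varphi_t:\Lambda\to\Lambda$ is the ring homomorphism with $\varphi_t h_r=h_{r/t}$ if $t\mid r$ and $\varphi_th_r=0$ otherwise. Skew Schur functions: $s_{\lambda/\mu}=\det_{1\le i,j\le N}(h_{\lambda_i-\mu_j-i+j})$ ($N\ge l(\lambda)$), and $s_{\lambda/\mu}=0$ if $\mu\not\subseteq\lambda$. Universal characters, for a partition $\lambda$ and any $N\ge l(\lambda)$: $\mathrm{sp}_\lambda=\tfrac12\det_{1\le i,j\le N}(h_{\lambda_i-i+j}+h_{\lambda_i-i-j+2})$, $\mathrm{so}_\lambda=\det_{1\le i,j\le N}(h_{\lambda_i-i+j}+h_{\lambda_i-i-j+1})$; for partitions $\lambda,\mu$, $\mathrm{rs}_{\lambda,\mu}=\sum_\nu(-1)^{|\nu|}s_{\lambda/\nu}s_{\mu/\nu'}$ (sum over partitions $\nu$, $\nu'$ the conjugate). Frobenius rank $\mathrm{rk}(\lambda)$ is the number of $i$ with $\lambda_i\ge i$; Frobenius notation $\lambda=(a_1,\dots,a_k\mid b_1,\dots,b_k)$ with $k=\mathrm{rk}(\lambda)$, $a_i=\lambda_i-i$, $b_i=\lambda'_i-i$. $\lambda$ is symplectic if $b_i=a_i+1$ for all $i$. Beta sets, cores and quotients: for $N\ge l(\lambda)$ let $\beta(\lambda;N)=\{\lambda_i+N-i:1\le i\le N\}$ and $m_r(\lambda;N)$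 the number of its elements $\equiv r\pmod t$. Writing the elements in class $r$ as $\xi^{(r)}_kt+r$, $\xi^{(r)}_1>\cdots>\xi^{(r)}_{m_r}\ge0$, the $t$-quotient $(\lambda^{(0)},\dots,\lambda^{(t-1)})$ has $\lambda^{(r)}_k=\xi^{(r)}_k-m_r(\lambda;N)+k$; it is always computed with $N$ a multiple of $t$ (here $N=nt$). The $t$-core: list the integers $kt+r$ ($0\le k\le m_r(\lambda;N)-1$) decreasingly as $\tilde\xi_1>\cdots>\tilde\xi_N$, and $t\text{-core}(\lambda)_i=\tilde\xi_i-N+i$. $w_t(\lambda;N)$ is the permutation which rearranges the decreasing list $(\lambda_1+N-1,\dots,\lambda_N)$ of $\beta(\lambda;N)$ so that residues mod $t$ are weakly increasing and, within each residue class, the entries decrease; $\mathrm{sgn}(w_t(\lambda;N))$ is its sign. *)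

(* Defs.v *)
From HB Require Import structures.
From mathcomp Require Import all_boot all_order all_fingroup all_algebra.
From mathcomp Require Import boolp mpoly zify.

Set Implicit Arguments.
Unset Strict Implicit.
Unset Printing Implicit Defensive.

Import GRing.Theory.

Local Open Scope ring_scope.

(* The ring of symmetric functions over rat, as the inverse limit, in the     *)
(* category of graded rings, of the rings of symmetric polynomials: families  *)
(* (f n)_n with f n a symmetric polynomial in n variables, compatible with    *)
(* setting the last variable to 0, and of bounded degree.                     *)

Definition mpfam : Type := forall n : nat, {mpoly rat[n]}.

HB.instance Definition _ := gen_eqMixin mpfam.
HB.instance Definition _ := gen_choiceMixin mpfam.

Lemma mpfamP (f g : mpfam) : (forall n, f n = g n) -> f = g.
Proof. by move=> e; apply: functional_extensionality_dep. Qed.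

Section MpfamRing.
Implicit Types f g : mpfam.

Let fam0 : mpfam := fun=> 0.
Let fam1 : mpfam := fun=> 1.
Let famN f : mpfam := fun n => - f n.
Let famD f g : mpfam := fun n => f n + g n.
Let famM f g : mpfam := fun n => f n * g n.
Let famZ (c : rat) f : mpfam := fun n => c *: f n.

Let famDA : associative famD.
Proof. by move=> f g k; apply: mpfamP => n; apply: addrA. Qed.
Let famDC : commutative famD.
Proof. by move=> f g; apply: mpfamP => n; apply: addrC. Qed.
Let fam0D : left_id fam0 famD.
Proof. by move=> f; apply: mpfamP => n; apply: add0r. Qed.
Let famND : left_inverse fam0 famN famD.
Proof. by move=> f; apply: mpfamP => n; apply: addNr. Qed.

HB.instance Definition _ :=
  GRing.isZmodule.Build mpfam famDA famDC fam0D famND.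

Let famMA : associative famM.
Proof. by move=> f g k; apply: mpfamP => n; apply: mulrA. Qed.
Let famMC : commutative famM.
Proof. by move=> f g; apply: mpfamP => n; apply: mulrC. Qed.
Let fam1M : left_id fam1 famM.
Proof. by move=> f; apply: mpfamP => n; apply: mul1r. Qed.
Let famMD : left_distributive famM famD.
Proof. by move=> f g k; apply: mpfamP => n; apply: mulrDl. Qed.
Let fam1_neq0 : fam1 != fam0.
Proof.
apply/eqP=> e; have /eqP := congr1 (fun f : mpfam => f 0) e.
by rewrite (oner_eq0 {mpoly rat[0]}).
Qed.

HB.instance Definition _ :=
  GRing.Zmodule_isComNzRing.Build mpfam famMA famMC fam1M famMD fam1_neq0.

Let famZA a b f : famZ a (famZ b f) = famZ (a * b) f.
Proof. by apply: mpfamP => n; apply: scalerA. Qed.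
Let fam1Z : left_id 1 famZ.
Proof. by move=> f; apply: mpfamP => n; apply: scale1r. Qed.
Let famZDr : right_distributive famZ +%R.
Proof. by move=> c f g; apply: mpfamP => n; apply: scalerDr. Qed.
Let famZDl f : {morph famZ^~ f : a b / a + b}.
Proof. by move=> a b; apply: mpfamP => n; apply: scalerDl. Qed.

HB.instance Definition _ :=
  GRing.Zmodule_isLmodule.Build rat mpfam famZA fam1Z famZDr famZDl.

Let famZAl (c : rat) f g : c *: (f * g) = c *: f * g.
Proof. by apply: mpfamP => n; apply: scalerAl. Qed.

HB.instance Definition _ := GRing.Lmodule_isLalgebra.Build rat mpfam famZAl.

End MpfamRing.

Definition mrestr_vars n : n.+1.-tuple {mpoly rat[n]} :=
  [tuple (if unlift ord_max i is Some j then 'X_j else 0) | i < n.+1].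

(* setting the last of n.+1 variables to 0 *)
Definition mrestr n (p : {mpoly rat[n.+1]}) : {mpoly rat[n]} :=
  p \mPo mrestr_vars n.

HB.instance Definition _ n :=
  GRing.LRMorphism.copy (@mrestr n) (comp_mpoly (mrestr_vars n)).

Definition symfun_spec (f : mpfam) : Prop :=
  [/\ forall n, f n \is symmetric,
      forall n, mrestr (f n.+1) = f n
    & exists d, forall n, (msize (f n) <= d)%N].

Definition symfun_pred : {pred mpfam} := fun f => `[< symfun_spec f >].

Fact symfun_subalg : subalg_closed symfun_pred.
Proof.
split.
- apply/asboolP; split=> [n|n|]; first exact: rpred1.
    exact: (rmorph1 (@mrestr n)).
  by exists 1 => n; rewrite msize1.
- move=> c f g /asboolP[fs fr [d fd]] /asboolP[gs gr [e ge]]; apply/asboolP.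
  split=> [n|n|]; first by apply: (rpredD (rpredZ c (fs n)) (gs n)).
    by rewrite [LHS](raddfD (@mrestr n)) /= linearZ /= fr gr.
  exists (maxn d e) => n; apply: (leq_trans (msizeD_le _ _)).
  rewrite geq_max !leq_max ge orbT andbT.
  by rewrite (leq_trans (msizeZ_le _ _) (fd n)).
- move=> f g /asboolP[fs fr [d fd]] /asboolP[gs gr [e ge]]; apply/asboolP.
  split=> [n|n|]; first exact: (rpredM (fs n) (gs n)).
    by rewrite [LHS](rmorphM (@mrestr n)) /= fr gr.
  exists (d + e).+1 => n; apply: (leq_trans (msizeM_le _ _)).
  by rewrite ltnS leq_add.
Qed.

HB.instance Definition _ :=
  GRing.isSubalgClosed.Build rat mpfam symfun_pred symfun_subalg.

Record symfun : Type := SymFun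
  { symfun_fam :> mpfam; _ : symfun_fam \in symfun_pred }.

HB.instance Definition _ := [isSub for symfun_fam].
HB.instance Definition _ := [Choice of symfun by <:].
HB.instance Definition _ := [SubChoice_isSubComNzRing of symfun by <:].
HB.instance Definition _ := [SubZmodule_isSubLmodule of symfun by <:].
HB.instance Definition _ :=
  [SubNzRing_SubLmodule_isSubLalgebra of symfun by <:].


Definition hpoly r n : {mpoly rat[n]} :=
  \sum_(m : 'X_{1..n < r.+1} | mdeg m == r) 'X_[m].

Lemma mcoeff_hpoly r n (m : 'X_{1..n}) : (hpoly r n)@_m = (mdeg m == r)%:R.
Proof.
rewrite /hpoly raddf_sum /=; under eq_bigr do rewrite mcoeffX.
case: (eqVneq (mdeg m) r) => [e|ne].
  have lt : (mdeg m < r.+1)%N by rewrite e.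
  rewrite (bigD1 (BMultinom lt)) /= ?e // eqxx big1 ?addr0 // => k /andP[_ nk].
  by rewrite (negPf (_ : k != m :> 'X_{1..n})).
rewrite big1 // => k /eqP ek; case: eqP => // ekm.
by rewrite -ekm ek eqxx in ne.
Qed.

Lemma mcoeff_mrestr n (p : {mpoly rat[n.+1]}) (m : 'X_{1..n}) :
  (mrestr p)@_m = p@_(mnmwiden m).
Proof.
rewrite /mrestr comp_mpolyEX raddf_sum [in RHS](mpolyE p) raddf_sum /=.
apply: eq_bigr => k _; rewrite !mcoeffZ comp_mpolyX mcoeffX; congr (_ * _).
rewrite big_ord_recr /= tnth_mktuple unlift_none.
under eq_bigr => i _.
  rewrite tnth_mktuple (_ : widen_ord _ i = lift ord_max i); last first.
    by apply: val_inj; rewrite /= /bump leqNgt ltn_ord.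
  rewrite liftK; over.
pose k' := [multinom k (lift ord_max i) | i < n].
rewrite (_ : \prod_(i < n) _ = 'X_[k']); last first.
  by rewrite mpolyXE_id; apply: eq_bigr => i _; rewrite mnmE.
have [k0|k1] := posnP (k ord_max).
  rewrite k0 expr0 mulr1 mcoeffX; congr (_%:R); apply: congr1.
  apply/eqP/eqP => [<-|e].
    apply/mnmP => i; case: (unliftP ord_max i) => [j|] ->.
      rewrite (_ : lift ord_max j = widen_ord (leqnSn n) j) ?mnmwiden_widen.
        by rewrite mnmE; congr (k _); apply: val_inj;
           rewrite /= /bump leqNgt ltn_ord.
      by apply: val_inj; rewrite /= /bump leqNgt ltn_ord.
    by rewrite mnmwiden_ordmax.
  apply/mnmP => i; rewrite mnmE e -(mnmwiden_widen m i); congr (mnmwiden m _).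
  by apply: val_inj; rewrite /= /bump leqNgt ltn_ord.
rewrite expr0n eqn0Ngt k1 mulr0 mcoeff0; case: eqP => // e.
by rewrite e mnmwiden_ordmax in k1.
Qed.

Fact hsym_subproof r : (hpoly r : mpfam) \in symfun_pred.
Proof.
apply/asboolP; split=> [n|n|].
- by apply/issymP => s; apply/mpolyP => m; rewrite mcoeff_sym !mcoeff_hpoly
    mdeg_mperm.
- apply/mpolyP => m; rewrite mcoeff_mrestr !mcoeff_hpoly; congr (_ == _)%:R.
  rewrite !mdegE big_ord_recr /= mnmwiden_ordmax addn0.
  by apply: eq_bigr => i _; rewrite mnmwiden_widen.
- exists r.+1 => n; rewrite msizeE; apply/bigmax_leqP_seq => m + _.
  rewrite mcoeff_msupp mcoeff_hpoly; by case: (mdeg m =P r) => [->|].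
Qed.

Definition hsym (r : nat) : symfun := SymFun (hsym_subproof r).

Definition hsymz (k : int) : symfun := if k is Posz r then hsym r else 0.

Lemma hsym0 : hsym 0 = 1.
Proof.
apply: val_inj; apply: mpfamP => n; apply/mpolyP => m.
by rewrite [LHS]mcoeff_hpoly [RHS]mcoeff1 mdeg_eq0.
Qed.

(* Partitions are weakly decreasing sequences of positive integers; the part  *)
(* lambda_(i+1) is nth 0 lam i, which is 0 beyond the length.                 *)

Definition is_part (lam : seq nat) : bool := sorted geq lam && (0%N \notin lam).

Definition part (lam : seq nat) (i : nat) : nat := nth 0%N lam i.

Definition conj_part (lam : seq nat) : seq nat :=
  [seq count (fun x => j < x)%N lam | j <- iota 0 (part lam 0)].

Definition part_sub (mu lam : seq nat) : bool :=
  (size mu <= size lam)%N &&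
  all (fun i => part mu i <= part lam i)%N (iota 0 (size mu)).

Definition frob_rank (lam : seq nat) : nat :=
  count (fun i => i < part lam i)%N (iota 0 (size lam)).

(* Frobenius coordinates a_(i+1) and b_(i+1); the truncated subtractions are  *)
(* exact for i < frob_rank lam.                                               *)
Definition frob_a (lam : seq nat) (i : nat) : nat := (part lam i - i.+1)%N.
Definition frob_b (lam : seq nat) (i : nat) : nat := frob_a (conj_part lam) i.

Definition part_symplectic (lam : seq nat) : bool :=
  all (fun i => frob_b lam i == (frob_a lam i).+1) (iota 0 (frob_rank lam)).

(* Beta sets are listed in decreasing order; unbeta inverts the encoding of a *)
(* partition by its beta set (the truncated subtraction is exact on strictly  *)
(* decreasing sequences).                                                     *)

Definition beta (N : nat) (lam : seq nat) : seq nat :=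
  [seq (part lam i + (N - i.+1))%N | i <- iota 0 N].

Definition unbeta (s : seq nat) : seq nat :=
  [seq x <- [seq (nth 0 s i - (size s - i.+1))%N | i <- iota 0 (size s)]
     | (0 < x)%N].

Definition beta_class (t N : nat) (lam : seq nat) (r : nat) : seq nat :=
  [seq (x %/ t)%N | x <- beta N lam & (x %% t == r)%N].

Definition beta_mult (t N : nat) (lam : seq nat) (r : nat) : nat :=
  count (fun x => x %% t == r)%N (beta N lam).

(* the component lambda^(r) of the t-quotient *)
Definition tquot (t N : nat) (lam : seq nat) (r : nat) : seq nat :=
  unbeta (beta_class t N lam r).

Definition tcore (t N : nat) (lam : seq nat) : seq nat :=
  unbeta (sort geq
    [seq (k * t + r)%N | r <- iota 0 t, k <- iota 0 (beta_mult t N lam r)]).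

Definition residue_lt (t x y : nat) : bool :=
  (x %% t < y %% t)%N || (x %% t == y %% t)%N && (y < x)%N.

Definition residue_sorting (t N : nat) (lam : seq nat) (w : 'S_N) : bool :=
  sorted (residue_lt t) [seq nth 0%N (beta N lam) (w i) | i <- enum 'I_N].

(* the permutation w_t(lambda; N): see residue_sortP and residue_sort_uniq *)
Definition residue_sort (t N : nat) (lam : seq nat) : 'S_N :=
  odflt 1%g [pick w : 'S_N | residue_sorting t lam w].

Lemma size_beta N lam : size (beta N lam) = N.
Proof. by rewrite size_map size_iota. Qed.

Lemma nth_beta N lam i : (i < N)%N ->
  nth 0%N (beta N lam) i = (part lam i + (N - i.+1))%N.
Proof. by move=> ltiN; rewrite (nth_map 0%N) ?size_iota // nth_iota. Qed.

Lemma part_geq lam i j : is_part lam -> (i <= j)%N ->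
  (part lam j <= part lam i)%N.
Proof.
case/andP=> srt _ leij; rewrite /part.
have [lej|ltj] := leqP (size lam) j; first by rewrite nth_default.
by apply: (sorted_leq_nth (rev_trans leq_trans) leqnn 0%N srt);
  rewrite ?inE // (leq_ltn_trans leij).
Qed.

Lemma beta_inj N lam i j : is_part lam -> (i < N)%N -> (j < N)%N ->
  nth 0%N (beta N lam) i = nth 0%N (beta N lam) j -> i = j.
Proof.
move=> lamP; wlog ltij : i j / (i < j)%N => [hw|] iN jN.
  by case: (ltngtP i j) => // ltij e; [|apply: esym]; apply: hw.
rewrite !nth_beta // => /eqP; rewrite gtn_eqF // -addnS.
apply: leq_add; first exact: part_geq (ltnW ltij).
by apply: ltn_sub2l; rewrite ?ltnS // (leq_ltn_trans ltij).
Qed.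

Lemma residue_lt_trans t : transitive (residue_lt t).
Proof.
move=> y x z; rewrite /residue_lt.
case/orP=> [xy|/andP[/eqP-> yx]]; last first.
  by case: (ltngtP (y %% t) (z %% t)) => //= _ zy; apply: ltn_trans yx.
by case/orP=> [yz|/andP[/eqP<- _]]; rewrite ?(ltn_trans xy yz) ?xy.
Qed.

Lemma residue_lt_irr t : irreflexive (residue_lt t).
Proof. by move=> x; rewrite /residue_lt !ltnn andbF. Qed.

Lemma beta_permE N lam (w : 'S_N) :
  perm_eq [seq nth 0%N (beta N lam) (w i) | i <- enum 'I_N] (beta N lam).
Proof.
have e : beta N lam = [seq nth 0%N (beta N lam) (i : 'I_N) | i <- enum 'I_N].
  rewrite -{1}(mkseq_nth 0%N (beta N lam)) size_beta /mkseq -val_enum_ord.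
  by rewrite -map_comp.
rewrite [X in perm_eq _ X]e (map_comp (fun i : 'I_N => nth 0%N _ i) w).
apply: perm_map; apply: uniq_perm.
- by rewrite map_inj_uniq ?enum_uniq //; apply: perm_inj.
- exact: enum_uniq.
move=> i; rewrite mem_enum; apply/mapP; exists (w^-1 i)%g; rewrite ?mem_enum //.
by rewrite permKV.
Qed.

Lemma beta_uniq N lam : is_part lam -> uniq (beta N lam).
Proof.
move=> lamP; apply/(uniqP 0%N) => i j; rewrite !inE size_beta.
exact: beta_inj.
Qed.

Lemma residue_sortP t N lam :
  is_part lam -> residue_sorting t lam (residue_sort t N lam).
Proof.
move=> lamP; rewrite /residue_sort; case: pickP => //= no.
pose le x y := (x == y) || residue_lt t x y.
have le_total : total le.
  move=> x y; rewrite /le /residue_lt.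
  by case: (ltngtP (x %% t) (y %% t)); case: (ltngtP x y).
pose s := sort le (beta N lam).
have szs : size s == N by rewrite size_sort size_beta.
have szb : size (beta N lam) == N by rewrite size_beta.
have /tuple_permP[w ew] : perm_eq s (Tuple szb) by rewrite perm_sort.
suff sw : residue_sorting t lam w by rewrite no in sw.
rewrite /residue_sorting.
have -> : [seq nth 0%N (beta N lam) (w i) | i <- enum 'I_N] = s.
  rewrite ew /=; apply: eq_map => i; rewrite (tnth_nth 0%N) //.
have le_trans : transitive le.
  move=> y x z; rewrite /le => /predU1P[->//|xy] /predU1P[<-|yz].
    by rewrite xy orbT.
  by rewrite (residue_lt_trans xy yz) orbT.
have := sort_sorted le_total (beta N lam); rewrite -/s => srt.
have un : uniq s by rewrite sort_uniq beta_uniq.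
rewrite (sorted_pairwise le_trans) in srt; rewrite uniq_pairwise in un.
rewrite (sorted_pairwise (@residue_lt_trans t)).
have : pairwise [rel x y | (x != y) && le x y] s.
  by rewrite pairwise_relI; apply/andP.
by apply: sub_pairwise => x y /= /andP[/negPf nxy]; rewrite /le nxy.
Qed.

Lemma residue_sort_uniq t N lam (w : 'S_N) :
  is_part lam -> residue_sorting t lam w -> w = residue_sort t N lam.
Proof.
move=> lamP ws; have ws' := residue_sortP t N lamP.
apply/permP => i; apply: val_inj.
apply: (beta_inj lamP (ltn_ord (w i)) (ltn_ord _)).
have e := irr_sorted_eq (@residue_lt_trans t) (residue_lt_irr t) ws ws'.
have {}e := e (fun x => etrans (perm_mem (beta_permE lam w) x)
  (esym (perm_mem (beta_permE lam (residue_sort t N lam)) x))).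
by have /(_ i (mem_enum _ i)) := (eq_in_map _ _ _).2 e; apply.
Qed.

(* Jacobi-Trudi determinants: rows and columns are indexed from 0, so the     *)
(* indices i - 1 and j - 1 of the usual formulas are i and j here.            *)

Definition skew_schur (lam mu : seq nat) : symfun :=
  if part_sub mu lam then
    \det (\matrix_(i < size lam, j < size lam)
            hsymz ((part lam i)%:Z - (part mu j)%:Z - i%:Z + j%:Z))
  else 0.

Definition so_det (N : nat) (lam : seq nat) : symfun :=
  \det (\matrix_(i < N, j < N)
          (hsymz ((part lam i)%:Z - i%:Z + j%:Z)
           + hsymz ((part lam i)%:Z - i%:Z - j%:Z - 1))).

Definition sp_det (N : nat) (lam : seq nat) : symfun :=
  (2%:R : rat)^-1 *:
  \det (\matrix_(i < N, j < N)
          (hsymz ((part lam i)%:Z - i%:Z + j%:Z)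
           + hsymz ((part lam i)%:Z - i%:Z - j%:Z))).

Lemma det_last (R : comNzRingType) (N : nat) (F : nat -> nat -> R) :
  (forall j, (j <= N)%N -> F N j = (j == N)%:R) ->
  \det (\matrix_(i < N.+1, j < N.+1) F i j)
  = \det (\matrix_(i < N, j < N) F i j).
Proof.
move=> H; rewrite (expand_det_row _ ord_max) (bigD1 ord_max) //= mxE H //.
rewrite eqxx mul1r.
rewrite big1 ?addr0; last first.
  move=> j nj; rewrite mxE H; last by rewrite -ltnS.
  rewrite (_ : (j == N :> nat) = false) ?mul0r //.
  by apply: contraNF nj => /eqP e; apply/eqP/val_inj.
rewrite /cofactor -signr_odd oddD addbb mul1r; congr (\det _).
by apply/matrixP => i j; rewrite !mxE /= /bump !(leqNgt N) !ltn_ord.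
Qed.

Lemma hsymzN (k : int) : (k < 0)%R -> hsymz k = 0.
Proof. by case: k. Qed.

Lemma sp_detS N lam : (0 < N)%N -> (size lam <= N)%N ->
  sp_det N.+1 lam = sp_det N lam.
Proof.
move=> N0 le; rewrite /sp_det; congr (_ *: _).
apply: (det_last (F := fun i j =>
  hsymz ((part lam i)%:Z - i%:Z + j%:Z)
  + hsymz ((part lam i)%:Z - i%:Z - j%:Z))) => j lj.
rewrite /part nth_default // [X in _ + X]hsymzN ?addr0; last by lia.
case: eqP => [->|ne]; last by rewrite hsymzN //; lia.
by rewrite sub0r addNr; apply: hsym0.
Qed.

Lemma so_detS N lam : (size lam <= N)%N -> so_det N.+1 lam = so_det N lam.
Proof.
move=> le; rewrite /so_det.
apply: (det_last (F := fun i j =>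
  hsymz ((part lam i)%:Z - i%:Z + j%:Z)
  + hsymz ((part lam i)%:Z - i%:Z - j%:Z - 1))) => j lj.
rewrite /part nth_default // [X in _ + X]hsymzN ?addr0; last by lia.
case: eqP => [->|ne]; last by rewrite hsymzN //; lia.
by rewrite sub0r addNr; apply: hsym0.
Qed.

Definition so (lam : seq nat) : symfun := so_det (size lam) lam.

(* N must be positive: for the empty partition, N = 0 would give 1/2 and not  *)
(* 1. By sp_detS and so_detS the choice of N is otherwise immaterial.         *)
Definition sp (lam : seq nat) : symfun := sp_det (size lam).+1 lam.

(* nu ranges over the partitions with at most size lam parts, all at most     *)
(* lambda_1; the other partitions are not contained in lam and contribute 0.  *)
Definition rs (lam mu : seq nat) : symfun :=
  \sum_(nu : (size lam).-bseq 'I_(part lam 0).+1 | is_part (map val nu))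
     (-1) ^+ sumn (map val nu)
     * skew_schur lam (map val nu) * skew_schur mu (conj_part (map val nu)).

Definition eps_sp (t n : nat) (lam : seq nat) : nat :=
  (\sum_(t./2 <= r < t.-1) 'C((beta_mult t (n * t) lam r).+1, 2)
   + (if odd t then 0
      else 'C(n.+1, 2) + n * frob_rank (tcore t (n * t) lam)))%N.

(* Main.v *)
(* Label the rows of the determinant of sp_lambda by the beta set of lambda.
   After phi_t the entry at (x, j) vanishes unless j = x + 1 or j = - (x + 1)
   mod t, so grouping rows and columns by residue makes the matrix block
   diagonal: the rows of residue r and t - 2 - r meet the 2n columns of residues
   r + 1 and t - 1 - r, while residue t - 1 (and t/2 - 1 for t even) is paired
   with itself. The blocks must be square for the determinant to be nonzero,
   which says m_r + m_(t-2-r) = 2n and m_(t-1) = n; on the core this is the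
   symmetry of the beta set under x |-> 2nt - 2 - x that characterizes symplectic
   partitions. The self-paired blocks are the determinants of sp and so; the
   other ones are h(lambda_i - i + q) stacked over h(mu_i - i - 1 - q), and
   Laplace expansion along the top rows gives rs: the column sets correspond to
   partitions nu in a rectangle and the complementary sets to their conjugates. *)
Require Import Defs.
From mathcomp Require Import all_boot all_order all_fingroup all_algebra.
From mathcomp Require Import zify ring.

Set Implicit Arguments.
Unset Strict Implicit.
Unset Printing Implicit Defensive.

Import GRing.Theory.

Local Open Scope ring_scope.

(** * Determinants with rows and columns labelled by lists *)

Section SeqDet.

Variable R : comNzRingType.

(** Labelling by lists turns the regrouping of rows and columns into concatenation and reordering of
    lists. The dimension is read off the row list [s]; [c] is meant to have the same length. *)
Definition dets (T U : Type) (x0 : T) (y0 : U) (F : T -> U -> R)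
    (s : seq T) (c : seq U) : R :=
  \det (\matrix_(i < size s, j < size s) F (nth x0 s i) (nth y0 c j)).

Lemma eq_det n (f g : nat -> nat -> R) :
  (forall i j, (i < n)%N -> (j < n)%N -> f i j = g i j) ->
  \det (\matrix_(i < n, j < n) f i j) = \det (\matrix_(i < n, j < n) g i j).
Proof. by move=> e; congr (\det _); apply/matrixP=> i j; rewrite !mxE e. Qed.

Lemma detsE T U (x0 : T) (y0 : U) F s c n (g : nat -> nat -> R) :
  size s = n ->
  (forall i j, (i < n)%N -> (j < n)%N -> F (nth x0 s i) (nth y0 c j) = g i j) ->
  dets x0 y0 F s c = \det (\matrix_(i < n, j < n) g i j).
Proof.
move=> <- e; exact: (eq_det (f := fun i j => F (nth x0 s i) (nth y0 c j)) e).
Qed.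

Lemma eq_dets T U T' U' (x0 : T) (y0 : U) (x1 : T') (y1 : U') F F' s c s' c' :
  size s = size s' ->
  (forall i j, (i < size s)%N -> (j < size s)%N ->
     F (nth x0 s i) (nth y0 c j) = F' (nth x1 s' i) (nth y1 c' j)) ->
  dets x0 y0 F s c = dets x1 y1 F' s' c'.
Proof.
move=> es e; rewrite [RHS]/dets -es.
exact: (detsE (g := fun i j => F' (nth x1 s' i) (nth y1 c' j)) erefl e).
Qed.

Lemma dets_tr T U (x0 : T) (y0 : U) F s c : size s = size c ->
  dets x0 y0 F s c = dets y0 x0 (fun y x => F x y) c s.
Proof.
by move=> e; rewrite /dets -det_tr e; congr (\det _); apply/matrixP=> i j; rewrite !mxE.
Qed.

(** The matrix is block lower triangular. *)
Lemma dets_cat T U (x0 : T) (y0 : U) F s1 s2 c1 c2 : size s1 = size c1 ->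
  (forall i j, (i < size s1)%N -> (j < size s2)%N ->
     F (nth x0 s1 i) (nth y0 c2 j) = 0) ->
  dets x0 y0 F (s1 ++ s2) (c1 ++ c2) = dets x0 y0 F s1 c1 * dets x0 y0 F s2 c2.
Proof.
move=> e e0; rewrite [LHS]/dets size_cat.
rewrite -[X in \det X = _]submxK (_ : ursubmx _ = 0); last first.
  apply/matrixP=> i j; rewrite !mxE /= !nth_cat /= ltn_ord -e.
  by rewrite ltnNge leq_addr /= addKn e0.
rewrite det_lblock; congr (_ * _); congr (\det _); apply/matrixP=> i j; rewrite !mxE /=.
  by rewrite !nth_cat -e !ltn_ord.
by rewrite !nth_cat -e !ltnNge !leq_addr /= !addKn.
Qed.

Lemma dets_swap T U (x0 : T) (y0 : U) F x y s1 s2 c :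
  dets x0 y0 F (s1 ++ x :: y :: s2) c = - dets x0 y0 F (s1 ++ y :: x :: s2) c.
Proof.
set n := size s1.
have -> : dets x0 y0 F (s1 ++ x :: y :: s2) c =
    \det (\matrix_(i < n + (size s2).+2, j < n + (size s2).+2)
             F (nth x0 (s1 ++ x :: y :: s2) i) (nth y0 c j)).
  by apply: (detsE (g := fun i j => F (nth x0 _ i) (nth y0 _ j))); rewrite ?size_cat.
have -> : dets x0 y0 F (s1 ++ y :: x :: s2) c =
    \det (\matrix_(i < n + (size s2).+2, j < n + (size s2).+2)
             F (nth x0 (s1 ++ y :: x :: s2) i) (nth y0 c j)).
  by apply: (detsE (g := fun i j => F (nth x0 _ i) (nth y0 _ j))); rewrite ?size_cat.
have l1 : (n < n + (size s2).+2)%N by lia.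
have l2 : (n.+1 < n + (size s2).+2)%N by lia.
pose i1 := Ordinal l1; pose i2 := Ordinal l2.
have ne : i1 != i2 by rewrite -val_eqE /=; lia.
set A := (X in _ = - \det X).
rewrite (_ : (\matrix_(i, j) _) = xrow i1 i2 A); last first.
  apply/matrixP=> i j; rewrite !mxE; congr (F _ _).
  case: tpermP => [->|->|/eqP + /eqP]; rewrite -?val_eqE /= ?nth_cat -/n ?ltnn ?subnn //.
  - by rewrite ltnNge leqnSn /= subSnn.
  - by rewrite ltnNge leqnSn /= subSnn.
  move=> n1 n2; case: ltnP => // le; case: (i - n)%N (subnKC le) => [|[|k]] //; lia.
by rewrite xrowE det_mulmx det_perm odd_tperm ne expr1 mulN1r.
Qed.

Lemma detsN0 T U (x0 : T) (y0 : U) F s c : dets x0 y0 F s c != 0 ->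
  exists w : 'S_(size s),
    forall i : 'I_(size s), F (nth x0 s i) (nth y0 c (w i)) != 0.
Proof.
move=> nz; have : [exists w : 'S_(size s),
    [forall i : 'I_(size s), F (nth x0 s i) (nth y0 c (w i)) != 0]].
  apply: contraNT nz; rewrite negb_exists => /forallP no.
  rewrite /dets /determinant big1 // => w _.
  have := no w; rewrite negb_forall => /existsP[i].
  by rewrite negbK => /eqP wi; rewrite (bigD1 i) //= mxE wi mul0r mulr0.
by case/existsP=> w /forallP wP; exists w.
Qed.

(** The permutation of a nonzero Leibniz term is a bijection from rows to columns that carries the
    class [p] onto the class [q]. This is what forces the blocks to be square. *)
Lemma dets_classes T U (x0 : T) (y0 : U) F s c (p : pred T) (q : pred U) :
  size s = size c -> dets x0 y0 F s c != 0 ->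
  (forall i j, (i < size s)%N -> (j < size s)%N -> F (nth x0 s i) (nth y0 c j) != 0 ->
    p (nth x0 s i) = q (nth y0 c j)) ->
  count p s = count q c.
Proof.
move=> e nz H; case: (detsN0 nz) => w wP.
have cnt V (v0 : V) (a : pred V) u :
    count a u = (\sum_(i < size u) a (nth v0 u i))%N.
  by rewrite -sum1_count (big_nth v0) big_mkord big_mkcond; apply: eq_bigr=> i _; case: ifP.
rewrite (cnt _ x0) (cnt _ y0) -e [RHS](reindex_inj (@perm_inj _ w)).
by apply: eq_bigr=> i _; rewrite (H i (w i)).
Qed.

End SeqDet.

(** * Signed rearrangements of rows and columns *)

Section Swaps.

Variable R : comNzRingType.

Lemma dets_nil T U (x0 : T) (y0 : U) (F : T -> U -> R) c :
  dets x0 y0 F [::] c = 1.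
Proof. by rewrite /dets det_mx00. Qed.

Lemma dets_cat_in (T U : eqType) (x0 : T) (y0 : U) (F : T -> U -> R) s1 s2 c1 c2 :
  size s1 = size c1 -> size s2 = size c2 ->
  (forall x y, x \in s1 -> y \in c2 -> F x y = 0) ->
  dets x0 y0 F (s1 ++ s2) (c1 ++ c2) = dets x0 y0 F s1 c1 * dets x0 y0 F s2 c2.
Proof.
move=> e1 e2 F0; apply: dets_cat => // i j ilt jlt.
by apply: F0; apply: mem_nth; rewrite -?e2.
Qed.

(* Quantifying over the context p, q makes this a congruence for ++. *)
Definition swaps (U : Type) (k : nat) (c c' : seq U) : Prop :=
  size c = size c' /\
  forall (T : Type) (x0 : T) (y0 : U) (F : T -> U -> R) s p q,
    size s = size (p ++ c ++ q) ->
    dets x0 y0 F s (p ++ c ++ q) = (-1) ^+ k * dets x0 y0 F s (p ++ c' ++ q).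

Section SwapsU.

Variable U : Type.
Implicit Types c d p q : seq U.

Lemma swaps_cols k c c' T (x0 : T) (y0 : U) (F : T -> U -> R) s :
  swaps k c c' -> size s = size c ->
  dets x0 y0 F s c = (-1) ^+ k * dets x0 y0 F s c'.
Proof.
case=> _ H e; have := H T x0 y0 F s [::] [::].
by rewrite !cats0 /=; apply.
Qed.

Lemma swaps_rows k c c' T (x0 : T) (y0 : U) (F : U -> T -> R) s :
  swaps k c c' -> size s = size c ->
  dets y0 x0 F c s = (-1) ^+ k * dets y0 x0 F c' s.
Proof.
move=> H e; rewrite dets_tr // (swaps_cols _ _ _ H) //; congr (_ * _).
by rewrite [RHS]dets_tr // -(proj1 H).
Qed.

Lemma swaps_refl c : swaps 0 c c.
Proof. by split=> // *; rewrite mul1r. Qed.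

Lemma swaps_trans k l c1 c2 c3 :
  swaps k c1 c2 -> swaps l c2 c3 -> swaps (k + l) c1 c3.
Proof.
case=> e1 H1 [e2 H2]; split=> [|T x0 y0 F s p q e]; first by rewrite e1.
by rewrite H1 // H2 ?mulrA ?exprD // e !size_cat e1.
Qed.

Lemma swaps_ctx k p q c c' : swaps k c c' -> swaps k (p ++ c ++ q) (p ++ c' ++ q).
Proof.
case=> e H; split=> [|T x0 y0 F s p' q' es]; first by rewrite !size_cat e.
have := H T x0 y0 F s (p' ++ p) (q ++ q'); rewrite -!catA; apply.
by rewrite es -!catA.
Qed.

Lemma swaps_catl k p c c' : swaps k c c' -> swaps k (p ++ c) (p ++ c').
Proof. by move=> H; have := swaps_ctx p [::] H; rewrite !cats0. Qed.

Lemma swaps_catr k q c c' : swaps k c c' -> swaps k (c ++ q) (c' ++ q).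
Proof. exact: (@swaps_ctx _ [::]). Qed.

Lemma swaps_adj (x y : U) : swaps 1 [:: x; y] [:: y; x].
Proof.
split=> // T x0 y0 F s p q e; rewrite expr1 mulN1r dets_tr // dets_swap.
by congr (- _); rewrite [RHS]dets_tr // e !size_cat.
Qed.

Lemma swaps_move (x : U) c : swaps (size c) (x :: c) (c ++ [:: x]).
Proof.
elim: c => [|y c IH]; first exact: swaps_refl.
exact: swaps_trans (swaps_catr c (swaps_adj x y)) (swaps_catl [:: y] IH).
Qed.

Lemma swaps_block c d : swaps (size c * size d) (c ++ d) (d ++ c).
Proof.
elim: c => [|x c IH]; first by rewrite cats0; apply: swaps_refl.
rewrite /= mulSn addnC; apply: swaps_trans (swaps_catl [:: x] IH) _.
by have := swaps_catr c (swaps_move x d); rewrite -catA.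
Qed.

Lemma swaps_rev c : swaps 'C(size c, 2) c (rev c).
Proof.
elim: c => [|x c IH]; first exact: swaps_refl.
rewrite /= binS bin1 rev_cons -cats1 -{2}(size_rev c).
exact: swaps_trans (swaps_catl [:: x] IH) (swaps_move x (rev c)).
Qed.

(** Each one-element block [B i] moves left past the blocks [A j] of the later indices [j], at a
    cost of [n] transpositions per block. *)
Lemma swaps_interleave (I : Type) (A B : I -> seq U) n (l : seq I) :
  (forall i, size (A i) = n) -> (forall i, size (B i) = 1%N) ->
  swaps (n * 'C(size l, 2)) (flatten (map A l) ++ flatten (map B l))
    (flatten [seq A i ++ B i | i <- l]).
Proof.
move=> sA sB; elim: l => [|i l IH] /=.
  by rewrite bin0n muln0; apply: swaps_refl.
have sz : size (flatten (map A l)) = (n * size l)%N.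
  elim: l {IH} => [|j l] /=; first by rewrite muln0.
  by rewrite size_cat sA mulnS => ->.
rewrite binS bin1 mulnDr addnC -!catA; apply: swaps_catl.
have := swaps_block (flatten (map A l)) (B i); rewrite sB muln1 sz => H.
have := swaps_catr (flatten (map B l)) H; rewrite -!catA => H1.
exact: swaps_trans H1 (swaps_catl (B i) IH).
Qed.

End SwapsU.

Definition residue_class (t n r : nat) : seq nat := [seq (k * t + r)%N | k <- iota 0 n].

(** Induction on [n]: the last [t] columns contain one element of each residue class, and
    interleaving them with the classes already formed costs [n * 'C(t, 2)]. *)
Lemma swaps_residues t n :
  swaps ('C(n, 2) * 'C(t, 2)) (iota 0 (n * t))
    (flatten [seq residue_class t n r | r <- iota 0 t]).
Proof.
elim: n => [|n IH].
  by rewrite (_ : flatten _ = [::]); [apply: swaps_refl|elim: (iota 0 t)].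
rewrite mulSn addnC iotaD add0n binS bin1 mulnDl.
apply: swaps_trans (swaps_catr _ IH) _.
pose B r := [:: (n * t + r)%N].
rewrite (_ : iota (n * t) t = flatten (map B (iota 0 t))); last first.
  by rewrite /B flatten_map1 -[in LHS](addn0 (n * t)%N) iotaDl.
rewrite (_ : [seq residue_class t n.+1 r | r <- iota 0 t] =
    [seq residue_class t n r ++ B r | r <- iota 0 t]); last first.
  by apply: eq_map => r; rewrite /residue_class -addn1 iotaD map_cat.
rewrite -[X in 'C(X, 2)](size_iota 0 t); apply: swaps_interleave => // r.
by rewrite size_map size_iota.
Qed.

Lemma iota_ends j l : iota j l.+2 = j :: iota j.+1 l ++ [:: (j.+1 + l)%N].
Proof. by rewrite [LHS]/= -(iotaD _ l 1) addn1. Qed.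

(** The outer classes [k] and [M - k] are coupled only to each other. Moving the last class next to
    the first, among rows and among columns, splits off one diagonal block, and the induction
    continues inside. For odd [L] the middle class remains alone. *)
Lemma dets_peel (T U : eqType) (x0 : T) (y0 : U) (F : T -> U -> R)
    (A : nat -> seq T) (B : nat -> seq U) n M L k : (k + k + L)%N = M.+1 ->
  (forall r, (k <= r < k + L)%N -> size (B r) = n) ->
  (forall r, (k <= r < k + L)%N -> (size (A r) + size (A (M - r)) = n + n)%N) ->
  (forall r r' x y, (k <= r < k + L)%N -> (k <= r' < k + L)%N ->
     r' != r -> r' != (M - r)%N -> x \in A r -> y \in B r' -> F x y = 0) ->
  dets x0 y0 F (flatten (map A (iota k L))) (flatten (map B (iota k L))) =
  (-1) ^+ (\sum_(k <= r < k + L./2) n * L * (n + size (A (M - r))))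
  * \prod_(k <= r < k + L./2) dets x0 y0 F (A r ++ A (M - r)%N) (B r ++ B (M - r)%N)
  * (if odd L then dets x0 y0 F (A (k + L./2)%N) (B (k + L./2)%N) else 1).
Proof.
have [m] := ubnP L; elim: m L k => // m IH [|[|L]] k lt eM sB sA F0.
- by rewrite !big_geq ?dets_nil ?mulr1 ?expr0 // addn0.
- by rewrite /= !cats0 addn0 !big_geq // mulr1 mul1r.
have szB j l : (k <= j)%N -> (j + l <= k + L.+2)%N ->
    size (flatten (map B (iota j l))) = (n * l)%N.
  elim: l j => [|l IHl] j le1 le2 /=; first by rewrite muln0.
  by rewrite size_cat sB ?IHl ?mulnS //; lia.
(* Single row classes have unknown sizes; only pairs symmetric about M/2 are known to add up to
   [n + n], so the count also removes outer pairs. *)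
have szA : size (flatten (map A (iota k.+1 L))) = (n * L)%N.
  have szAA j l : (k <= j)%N -> (j + j + l)%N = M.+1 ->
      size (flatten (map A (iota j l))) = (n * l)%N.
    have [u] := ubnP l; elim: u l j => // u IHu [|[|l]] j ltu le1 le2.
    - by rewrite muln0.
    - rewrite /= cats0 muln1.
      by have := sA j; rewrite (_ : (M - j)%N = j); lia.
    rewrite iota_ends map_cons map_cat /= flatten_cat /= cats0 !size_cat.
    rewrite IHu; [|lia..]; have := sA j; rewrite (_ : (M - j)%N = (j.+1 + l)%N); lia.
  by apply: szAA; lia.
have eMk : (M - k = k.+1 + L)%N by lia.
have spl V (D : nat -> seq V) : flatten (map D (iota k L.+2)) =
    D k ++ flatten (map D (iota k.+1 L)) ++ D (M - k)%N.
  by rewrite iota_ends /= map_cat flatten_cat /= cats0 eMk.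
have sBk : size (B k) = n by apply: sB; lia.
have sBM : size (B (M - k)%N) = n by apply: sB; lia.
have sAk : (size (A k) + size (A (M - k)) = n + n)%N by apply: sA; lia.
rewrite !spl.
have H1 := swaps_catl (A k) (swaps_block (flatten (map A (iota k.+1 L))) (A (M - k)%N)).
have H2 := swaps_catl (B k) (swaps_block (flatten (map B (iota k.+1 L))) (B (M - k)%N)).
rewrite (swaps_rows _ _ _ H1); last by rewrite !size_cat szB ?szA; lia.
rewrite (swaps_cols _ _ _ H2); last by rewrite !size_cat szB ?szA; lia.
rewrite !(catA (_ k)) dets_cat_in; first last.
- move=> x y; rewrite mem_cat => xA /flattenP[_ /mapP[r + ->]].
  rewrite mem_iota => rl yB; case/orP: xA => xA.
    by apply: (F0 k r) => //; lia.
  by apply: (F0 (M - k)%N r) => //; lia.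
- by rewrite szA szB; lia.
- by rewrite !size_cat; lia.
rewrite IH; first last.
- move=> r r' x y h1 h2; apply: F0; lia.
- by move=> r h; apply: sA; lia.
- by move=> r h; apply: sB; lia.
- lia.
- lia.
have e2 : (k + L.+2./2)%N = (k.+1 + L./2)%N by rewrite /=; lia.
rewrite e2 !(big_ltn (m := k)); [|rewrite /=; lia..].
rewrite [odd L.+2]/= negbK szA szB; [|lia..].
set S := (\sum_(k.+1 <= r < _) n * L * _)%N.
set S' := (\sum_(k.+1 <= r < _) n * L.+2 * _)%N.
(* Only the parity of [L] matters for the sign and peeling lowers [L] by 2, so the same [L] can
   stand in the exponent at every stage. *)
have eS : odd S = odd S'.
  rewrite /S /S'; elim/big_rec2: _ => // r u v _.
  by rewrite !oddD !oddM /= negbK => ->.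
set d := dets _ _ _ (A k ++ _) _; set P := \prod_(_ <= r < _) _; set D := if _ then _ else _.
set a := size _; rewrite sBM.
rewrite (_ : (-1) ^+ (n * L.+2 * (n + a) + S') = (-1) ^+ (n * L * a + n * L * n + S) :> R).
  by rewrite !exprD; ring.
rewrite -signr_odd -[RHS]signr_odd; congr (_ ^+ nat_of_bool _).
rewrite !(oddD, oddM) /= negbK eS.
by case: (odd n); case: (odd L); case: (odd a); case: (odd S').
Qed.

End Swaps.

(** * Laplace expansion over partitions in a rectangle *)

(** Partitions with at most [a] parts, all at most [b], split according to whether the first part
    equals [b]. The recursion follows the expansion of a determinant along its first column in
    [dets_laplace]. *)
Fixpoint box (a : nat) : nat -> seq (seq nat) :=
  if a is a'.+1 then
    fix boxa (b : nat) : seq (seq nat) :=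
      if b is b'.+1 then map (cons b) (box a' b) ++ boxa b' else [:: [::]]
  else fun=> [:: [::]].

Lemma box0r a : box a 0 = [:: [::]].
Proof. by case: a. Qed.

Lemma boxSS a b : box a.+1 b.+1 = map (cons b.+1) (box a b.+1) ++ box a.+1 b.
Proof. by []. Qed.

Arguments box : simpl never.

Lemma box_leq a b nu x : nu \in box a b -> x \in nu -> (x <= b)%N.
Proof.
elim: a b nu => [|a IHa] b nu; first by rewrite inE => /eqP->.
elim: b nu => [|b IHb] nu; first by rewrite box0r inE => /eqP->.
rewrite boxSS mem_cat => /orP[/mapP[mu + ->]|/IHb + /[dup] xn]; last by move=> /[apply]; lia.
by move=> /IHa H; rewrite inE => /predU1P[->|/H].
Qed.

(** A conjugate part as a count, available without forming the list [conj_part]; [part_conj]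
    identifies the two for partitions. *)
Definition colen (nu : seq nat) (j : nat) : nat := count (fun x => j < x)%N nu.

Section Laplace.

Variable R : comNzRingType.

Definition rem_at (T : Type) i (s : seq T) := take i s ++ drop i.+1 s.

Lemma size_rem_at T i (s : seq T) : (i < size s)%N -> size (rem_at i s) = (size s).-1.
Proof. by move=> lt; rewrite size_cat size_drop size_takel //; lia. Qed.

Lemma nth_rem_at T (x0 : T) i (s : seq T) j : (i < size s)%N ->
  nth x0 (rem_at i s) j = nth x0 s (bump i j).
Proof.
move=> lt; rewrite nth_cat size_takel; last exact: ltnW.
rewrite nth_drop /bump; case: ltnP => h; last by congr nth; lia.
by rewrite nth_take //; congr nth; lia.
Qed.

Lemma rem_at_catl T i (s1 s2 : seq T) : (i < size s1)%N ->
  rem_at i (s1 ++ s2) = rem_at i s1 ++ s2.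
Proof.
move=> lt; rewrite /rem_at take_cat lt drop_cat -catA.
case: ltnP => // le; rewrite (_ : (i.+1 - size s1)%N = 0%N) ?drop0; last lia.
by rewrite drop_oversize.
Qed.

Lemma rem_at_catr T i (s1 s2 : seq T) :
  rem_at (size s1 + i) (s1 ++ s2) = s1 ++ rem_at i s2.
Proof.
rewrite /rem_at take_cat drop_cat !ltnNge leq_addr /= -addnS leq_addr /=.
by rewrite !addKn -catA.
Qed.

Lemma dets_cons T U (x0 : T) (y0 : U) (F : T -> U -> R) s y c : (0 < size s)%N ->
  dets x0 y0 F s (y :: c) =
  \sum_(i < size s) (-1) ^+ i * F (nth x0 s i) y * dets x0 y0 F (rem_at i s) c.
Proof.
case es: (size s) => [//|n] _.
rewrite (detsE (n := n.+1) (g := fun i j => F (nth x0 s i) (nth y0 (y :: c) j))) //.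
rewrite (expand_det_col _ ord0); apply: eq_bigr => i _.
rewrite mxE /cofactor addn0 mulrCA mulrA; congr (_ * _ * _).
rewrite (@detsE _ _ _ _ _ _ _ _ n
  (fun k j => F (nth x0 s (bump i k)) (nth y0 c j))); first last.
- by move=> k j _ _; rewrite nth_rem_at // es.
- by rewrite size_rem_at es.
by congr (\det _); apply/matrixP=> k j; rewrite !mxE.
Qed.

Lemma dets_map T U V (x0 : T) (y0 : U) (z0 : V) (g : V -> U) (F : T -> U -> R) s c :
  size s = size c ->
  dets x0 y0 F s (map g c) = dets x0 z0 (fun x z => F x (g z)) s c.
Proof.
by move=> e; apply: eq_dets => // i j _; rewrite e => lj; rewrite (nth_map z0).
Qed.

(* A partition nu in the a x b rectangle selects for s1 the columns j - nu_j; the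
   complementary columns, read from right to left, are nu'_j - j - 1. *)
Lemma dets_laplace T (x0 : T) (F : T -> int -> R) s1 s2 a b :
  size s1 = a -> size s2 = b ->
  dets x0 0 F (s1 ++ s2) [seq q%:Z - b%:Z | q <- iota 0 (a + b)] =
  \sum_(nu <- box a b) (-1) ^+ (a * b + sumn nu)
    * dets x0 0 F s1 (mkseq (fun j => j%:Z - (part nu j)%:Z) a)
    * dets x0 0 F s2 (rev (mkseq (fun j => (colen nu j)%:Z - j%:Z - 1) b)).
Proof.
move: {2}(a + b)%N (leqnn (a + b)) => m.
elim: m a b s1 s2 F => [|m IH] a b s1 s2 F lem e1 e2.
  have [a0 b0] : a = 0%N /\ b = 0%N by lia.
  rewrite {}a0 {}b0 in e1 e2 *.
  move: e1 e2; case: s1 => // _; case: s2 => // _.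
  by rewrite big_seq1 !dets_nil !mulr1.
case: a b e1 e2 lem => [|a] [|b] e1 e2 lem.
- move: e1 e2; case: s1 => // _; case: s2 => // _.
  by rewrite big_seq1 !dets_nil !mulr1.
- move: e1; case: s1 => // _; rewrite big_seq1 dets_nil mulr1 mul1r add0n cat0s.
  apply: eq_dets => // i j _; rewrite e2 => jb; congr (F _ _).
  rewrite nth_rev ?size_mkseq // nth_mkseq; last lia.
  by rewrite (nth_map 0%N) ?size_iota // nth_iota //= /colen /=; lia.
- move: e2; case: s2 => // _; rewrite box0r big_seq1 dets_nil mulr1 muln0 addn0 mul1r.
  rewrite cats0; apply: eq_dets => // i j _; rewrite e1 => jb; congr (F _ _).
  by rewrite nth_mkseq // (nth_map 0%N) ?size_iota // nth_iota //= /part nth_nil; lia.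
rewrite (_ : [seq _ | q <- _] = - b.+1%:Z :: [seq q%:Z - b%:Z | q <- iota 0 (a + b.+1)]); last first.
  rewrite addSn /= sub0r (iotaDl 1 0) -map_comp; congr (_ :: _).
  by apply: eq_map => q /=; lia.
(* The column [- b.+1] is taken either by a row of [s1], which means that the first part is [b.+1],
   or by a row of [s2], which means that all parts are at most [b]. *)
rewrite dets_cons ?size_cat ?e1 // big_split_ord /= boxSS big_cat; congr (_ + _).
  rewrite big_map.
  transitivity (\sum_(i < a.+1) \sum_(nu <- box a b.+1)
      (-1) ^+ i * F (nth x0 s1 i) (- b.+1%:Z) * ((-1) ^+ (a * b.+1 + sumn nu)
      * dets x0 0 F (rem_at i s1) (mkseq (fun j => j%:Z - (part nu j)%:Z + 1) a)
      * dets x0 0 F s2 (rev (mkseq (fun j => (colen nu j)%:Z - j%:Z) b.+1)))).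
    apply: eq_bigr => i _; rewrite nth_cat e1 ltn_ord -mulr_sumr.
    rewrite rem_at_catl ?e1 //; congr (_ * _).
    (* The induction hypothesis needs columns starting at [- b.+1]; the shift by one is absorbed
       into the entry function. *)
    rewrite (_ : [seq _ | q <- _] =
      map (fun z => z + 1) [seq q%:Z - b.+1%:Z | q <- iota 0 (a + b.+1)]); last first.
      by rewrite -map_comp; apply: eq_map => q /=; lia.
    have sr : size (rem_at i s1) = a by rewrite size_rem_at e1.
    rewrite (dets_map _ _ 0); last by rewrite size_cat sr e2 size_map size_iota.
    rewrite (IH a b.+1) //; apply: eq_bigr => nu _.
    rewrite -!(dets_map x0 0 0 (fun z => z + 1)) ?size_rev ?size_mkseq //.
    rewrite map_rev /mkseq -!map_comp.
    by congr (_ * _ * dets _ _ _ _ (rev _)); apply: eq_map => q /=; lia.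
  rewrite exchange_big /=; apply: eq_big_seq => nu nub.
  rewrite [mkseq _ a.+1](_ : _ = - b.+1%:Z :: mkseq (fun j => j%:Z - (part nu j)%:Z + 1) a); last first.
    rewrite /mkseq /= sub0r /part /= (iotaDl 1 0) -map_comp; congr (_ :: _).
    by apply: eq_map => q; rewrite /= add0n; move: (nth _ _ _) => z; lia.
  (* The rectangle and the partition both gain [b.+1] cells, so the parity is unchanged. *)
  rewrite (_ : (-1) ^+ (a.+1 * b.+1 + sumn (b.+1 :: nu)) = (-1) ^+ (a * b.+1 + sumn nu) :> R); last first.
    rewrite -signr_odd -[RHS]signr_odd; congr (_ ^+ nat_of_bool _).
    by rewrite mulSn [sumn _]/= addnACA oddD addnn odd_double addFb.
  (* A new part [b.+1] lengthens each of the first [b.+1] columns by one, which cancels the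
     [- 1]. *)
  rewrite (_ : mkseq (fun j => (colen (b.+1 :: nu) j)%:Z - j%:Z - 1) b.+1 =
    mkseq (fun j => (colen nu j)%:Z - j%:Z) b.+1); last first.
    apply/eq_in_map => j; rewrite mem_iota add0n => /andP[_ jb].
    rewrite /colen /=; move: (count _ nu) => z; rewrite jb; lia.
  move: (dets x0 0 F s2 _) => d2.
  rewrite dets_cons ?e1 // mulr_sumr mulr_suml; apply: eq_bigr => i _.
  by ring.
transitivity (\sum_(i < size s2) \sum_(nu <- box a.+1 b)
    (-1) ^+ (a.+1 + i) * F (nth x0 s2 i) (- b.+1%:Z) * ((-1) ^+ (a.+1 * b + sumn nu)
    * dets x0 0 F s1 (mkseq (fun j => j%:Z - (part nu j)%:Z) a.+1)
    * dets x0 0 F (rem_at i s2) (rev (mkseq (fun j => (colen nu j)%:Z - j%:Z - 1) b)))).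
  apply: eq_bigr => i _; rewrite nth_cat e1 ltnNge leq_addr addKn -mulr_sumr.
  rewrite -[X in rem_at (X + _)]e1 rem_at_catr; congr (_ * _); rewrite addnS -addSn.
  by apply: IH; rewrite ?size_rem_at ?e2 //; lia.
rewrite exchange_big /=; apply: eq_big_seq => nu nub.
rewrite [mkseq _ b.+1]mkseqS rev_rcons.
(* All parts are at most [b], so column [b] of the diagram is empty and the leftmost complementary
   column is [- b.+1]. *)
rewrite (_ : (colen nu b)%:Z - b%:Z - 1 = - (b + 1)%:Z); last first.
  rewrite (_ : colen nu b = 0%N); first lia.
  by apply/eqP; rewrite -leqn0 leqNgt -has_count; apply/hasPn => x /(box_leq nub); lia.
move: (dets x0 0 F s1 _) => d1.
rewrite dets_cons ?e2 // mulr_sumr addn1; apply: eq_bigr => i _.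
rewrite (_ : (-1) ^+ (a.+1 * b.+1 + sumn nu) =
  (-1) ^+ a.+1 * (-1) ^+ (a.+1 * b + sumn nu) :> R); first by rewrite exprD; ring.
by rewrite -exprD; congr (_ ^+ _); lia.
Qed.

End Laplace.

(** * Conjugate partitions, skew Schur determinants and [rs] *)

Lemma part_gt0 nu i : is_part nu -> (i < size nu)%N -> (0 < part nu i)%N.
Proof.
by case/andP=> _ n0 li; rewrite lt0n; apply: contraNneq n0 => <-; apply: mem_nth.
Qed.

Lemma is_part_cons x nu : is_part (x :: nu) = [&& (0 < x)%N, (part nu 0 <= x)%N & is_part nu].
Proof.
rewrite /is_part inE negb_or eq_sym -lt0n; case: nu => [|y nu] /=.
  by rewrite /part /= andbT.
by rewrite /part /= andbCA !andbA.
Qed.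

Lemma mem_box a b nu :
  (nu \in box a b) = [&& is_part nu, (size nu <= a)%N & (part nu 0 <= b)%N].
Proof.
elim: a b nu => [|a IHa] b nu.
  by rewrite inE; case: nu => [|x nu] //=; rewrite andbF.
elim: b nu => [|b IHb] nu.
  rewrite box0r inE; case: nu => [|x nu] //=.
  by rewrite is_part_cons /part /=; case: x => [|x] //=; rewrite ?andbF.
rewrite boxSS mem_cat IHb; case: nu => [|x nu] /=; first by rewrite orbT.
rewrite is_part_cons ltnS.
have -> : (x :: nu \in map (cons b.+1) (box a b.+1)) = (x == b.+1) && (nu \in box a b.+1).
  by apply/mapP/andP => [[m h [-> ->]]|[/eqP-> h]]; [rewrite eqxx|exists nu].
rewrite IHa; case: (ltngtP x b.+1) => h.
- by rewrite (_ : (x <= b)%N).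
- by rewrite (_ : (x <= b)%N = false) ?andbF //; lia.
- rewrite h ltnn !andbF orbF andbT /=.
  by case: (part nu 0 <= b.+1)%N; rewrite ?andbF ?andbT.
Qed.

Lemma box_uniq a b : uniq (box a b).
Proof.
elim: a b => [|a IHa] b //; elim: b => [|b IHb]; first by rewrite box0r.
rewrite boxSS cat_uniq IHb map_inj_uniq ?IHa => [|x y [] //].
rewrite andbT /=; apply/hasPn => nu; rewrite mem_box => /and3P[_ _ le].
by apply/mapP => -[m _ e]; rewrite e /part /= ltnn in le.
Qed.

Lemma size_conj nu : size (conj_part nu) = part nu 0.
Proof. by rewrite size_map size_iota. Qed.

Lemma part_conj nu j : is_part nu -> part (conj_part nu) j = colen nu j.
Proof.
move=> np; have [lt|ge] := ltnP j (part nu 0).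
  by rewrite /part (nth_map 0%N) ?size_iota // nth_iota.
rewrite /part nth_default ?size_conj //; apply/esym/eqP.
rewrite -leqn0 leqNgt -has_count; apply/hasPn => x /(nthP 0%N)[i _ <-].
by rewrite -leqNgt; apply: leq_trans (part_geq np (leq0n i)) ge.
Qed.

Lemma leq_colen nu i j : (i <= j)%N -> (colen nu j <= colen nu i)%N.
Proof. by move=> le; apply: sub_count => x; apply: leq_ltn_trans. Qed.

Lemma is_part_conj nu : is_part nu -> is_part (conj_part nu).
Proof.
move=> np; apply/andP; split.
  apply/(sortedP 0%N) => i; rewrite size_conj => lt.
  by rewrite -!/(part _ _) !part_conj //; apply: leq_colen.
apply/(nthP 0%N) => -[i]; rewrite size_conj -/(part _ _) part_conj // => lt /eqP.
rewrite -leqn0 leqNgt -has_count => /hasPn H; have {}H := H (part nu 0).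
by move: lt H; case: nu {np} => // x nu; rewrite /part /= inE eqxx => -> /(_ isT).
Qed.

Lemma skew_schur_pad lam nu a : (size lam <= a)%N -> part_sub nu lam ->
  \det (\matrix_(i < a, j < a)
     hsymz ((part lam i)%:Z - (part nu j)%:Z - i%:Z + j%:Z)) = skew_schur lam nu.
Proof.
move=> le sub; rewrite /skew_schur sub; case/andP: sub => sz _.
rewrite -(subnKC le); elim: (a - _)%N => [|k IH]; first by rewrite addn0.
rewrite addnS -{}IH; set n := (_ + k)%N.
apply: (det_last (F := fun i j =>
  hsymz ((part lam i)%:Z - (part nu j)%:Z - i%:Z + j%:Z))) => j jn.
have l0 : part lam n = 0%N by rewrite /part nth_default // leq_addr.
case: eqP => [->|ne]; last by rewrite hsymzN // l0; lia.
by rewrite l0 /part nth_default; [rewrite subr0 sub0r addNr; apply: hsym0|lia].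
Qed.

Lemma part_subPn nu lam a : is_part nu -> (size nu <= a)%N -> ~~ part_sub nu lam ->
  exists2 k, (k < a)%N & (part lam k < part nu k)%N.
Proof.
move=> np sz; rewrite negb_and -ltnNge => /orP[lt|/allPn[k]].
  by exists (size lam); [lia|rewrite {1}/part nth_default ?part_gt0].
by rewrite mem_iota -ltnNge => lk ltk; exists k => //; lia.
Qed.

(** The determinant agrees with [skew_schur] even when [nu] is not contained in [lam]: if lam_k <
    nu_k, the entries with column at most k and row at least k have negative index, and this zero
    block meets every Leibniz term. *)
Lemma skew_schurE lam nu a : is_part lam -> is_part nu ->
    (size lam <= a)%N -> (size nu <= a)%N ->
  \det (\matrix_(i < a, j < a)
     hsymz ((part lam i)%:Z - (part nu j)%:Z - i%:Z + j%:Z)) = skew_schur lam nu.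
Proof.
move=> lp np ll ln; case sub: (part_sub nu lam); first exact: skew_schur_pad.
rewrite /skew_schur sub; case/negbT/(part_subPn np ln): sub => k ka ltk.
apply: big1 => w _; apply/eqP.
suff [i] : exists i : 'I_a, (k <= i)%N && (w i <= k)%N.
  case/andP=> ki wk; rewrite (bigD1 i) //= mxE hsymzN ?mul0r ?mulr0 //.
  by have := part_geq lp ki; have := part_geq np wk; lia.
apply/existsP; rewrite -[X in is_true X]negbK negb_exists; apply/negP => /forallP H.
(* Otherwise [w] would map the a - k rows from k on injectively into the a - k - 1 columns after
   k. *)
pose S := [set i : 'I_a | (k <= i)%N].
have : (#|w @: S| <= #|S :\ Ordinal ka|)%N.
  apply/subset_leq_card/subsetP => _ /imsetP[i + ->]; rewrite !inE => ki.
  by have := H i; rewrite ki -ltnNge /= => lt; rewrite -val_eqE /= gtn_eqF // ltnW.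
rewrite card_imset; last exact: perm_inj.
by rewrite [X in (X <= _)%N](cardsD1 (Ordinal ka)) inE /= leqnn ltnn.
Qed.

Lemma eq_big_supp (V : zmodType) (I : eqType) (s s' : seq I) (G : I -> V) :
  uniq s -> uniq s' ->
  (forall i, i \in s -> i \notin s' -> G i = 0) ->
  (forall i, i \in s' -> i \notin s -> G i = 0) ->
  \sum_(i <- s) G i = \sum_(i <- s') G i.
Proof.
move=> us us' H H'.
have supp (u u' : seq I) : (forall i, i \in u -> i \notin u' -> G i = 0) ->
    \sum_(i <- u) G i = \sum_(i <- [seq i <- u | i \in u']) G i.
  move=> h; rewrite big_filter (bigID (mem u')) /= [X in _ + X]big1_seq ?addr0 //.
  by move=> i /andP[]; auto.
rewrite (supp _ _ H) (supp _ _ H'); apply: perm_big; apply: uniq_perm.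
- exact: filter_uniq.
- exact: filter_uniq.
by move=> i; rewrite !mem_filter andbC.
Qed.

(** The bounding rectangle of [lam] is exchanged for the a x b one. A partition only in the former
    has a conjugate longer than [mu]; one only in the latter does not fit in [lam]. Both contribute
    0. *)
Lemma rs_box lam mu a b : is_part lam -> is_part mu ->
    (size lam <= a)%N -> (size mu <= b)%N ->
  rs lam mu = \sum_(nu <- box a b)
    (-1) ^+ sumn nu * skew_schur lam nu * skew_schur mu (conj_part nu).
Proof.
move=> lp mp la mb; pose G nu := (-1) ^+ sumn nu * skew_schur lam nu * skew_schur mu (conj_part nu).
pose B := {bseq (size lam) of 'I_(part lam 0).+1}.
pose v (nu : B) : seq nat := map val nu.
have -> : rs lam mu = \sum_(nu <- [seq v nu | nu in [pred nu : B | is_part (v nu)]]) G nu.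
  by rewrite big_image.
have memX nu : (nu \in [seq v nu | nu in [pred nu : B | is_part (v nu)]]) =
    (nu \in box (size lam) (part lam 0)).
  rewrite mem_box; apply/mapP/and3P => [[u + ->]|[np sz le]].
    rewrite mem_enum inE => up; split=> //; first by rewrite size_map size_bseq.
    by rewrite /v; case: (bseqval u) => [|x s] //; rewrite /part /= -ltnS ltn_ord.
  have szu : (size (map (@inord (part lam 0)) nu) <= size lam)%N by rewrite size_map.
  have e : nu = v (Bseq szu).
    rewrite /v /= -map_comp -[LHS]map_id; apply/eq_in_map => x /(nthP 0%N)[i _ <-] /=.
    by rewrite inordK // ltnS; apply: leq_trans (part_geq np (leq0n i)) le.
  by exists (Bseq szu) => //; rewrite mem_enum inE -e.
apply: eq_big_supp.
- rewrite map_inj_uniq ?enum_uniq // => x y /(inj_map val_inj) e; exact: val_inj.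
- exact: box_uniq.
- move=> nu; rewrite memX !mem_box => /and3P[np sz le]; rewrite np (leq_trans sz la) /= => gt.
  rewrite /G [skew_schur mu _]/skew_schur ifN ?mulr0 //; apply: contra gt => /andP[+ _].
  by rewrite size_conj => /leq_trans; apply.
move=> nu; rewrite memX !mem_box => /and3P[np sz le]; rewrite np /= => gt.
rewrite /G [skew_schur lam _]/skew_schur ifN ?mulr0 ?mul0r //; apply: contra gt => /andP[sl /allP H].
rewrite sl /=; case: (posnP (size nu)) => [/size0nil->//|pos].
by have := H 0%N; rewrite mem_iota; apply.
Qed.

(** Laplace expansion along the top [a] rows. For each [nu] the minors are the determinants of the
    skew Schur functions of lam/nu and mu/nu', the latter after reversing its [b] columns, whence
    the sign exponent ['C(b, 2)]. *)
Lemma rs_det lam mu a b : is_part lam -> is_part mu ->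
    (size lam <= a)%N -> (size mu <= b)%N ->
  dets 0%N 0 (fun i q => if (i < a)%N then hsymz ((part lam i)%:Z - i%:Z + q)
     else hsymz ((part mu (i - a))%:Z - (i - a)%:Z - 1 - q))
    (iota 0 (a + b)) [seq q%:Z - b%:Z | q <- iota 0 (a + b)]
  = (-1) ^+ (a * b + 'C(b, 2)) * rs lam mu.
Proof.
move=> lp mp la mb; rewrite {1}iotaD add0n (dets_laplace _ _ (size_iota _ _) (size_iota _ _)).
rewrite (rs_box lp mp la mb) mulr_sumr; apply: eq_big_seq => nu.
rewrite mem_box => /and3P[np sn ln].
set F := (fun _ _ => _).
have -> : dets 0%N 0 F (iota 0 a) (mkseq (fun j => j%:Z - (part nu j)%:Z) a) = skew_schur lam nu.
  rewrite -(skew_schurE lp np la sn).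
  apply: (detsE (g := fun i j => hsymz ((part lam i)%:Z - (part nu j)%:Z - i%:Z + j%:Z))); rewrite ?size_iota // => i j li lj.
  by rewrite nth_iota // nth_mkseq // /F add0n li; congr hsymz; ring.
set c := mkseq _ b; have sc : size c = b by rewrite size_mkseq.
have R := @swaps_rev symfun _ (rev c); rewrite revK size_rev sc in R.
rewrite (swaps_cols _ _ _ R) ?size_rev ?size_iota //.
have -> : dets 0%N 0 F (iota a b) c = skew_schur mu (conj_part nu).
  rewrite -(skew_schurE mp (is_part_conj np) mb _) ?size_conj //.
  apply: (detsE (g := fun i j =>
    hsymz ((part mu i)%:Z - (part (conj_part nu) j)%:Z - i%:Z + j%:Z))); rewrite ?size_iota // => i j li lj.
  rewrite nth_iota // nth_mkseq // /F ltnNge leq_addr addKn part_conj //.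
  by congr hsymz; ring.
by rewrite !exprD; ring.
Qed.

(** * Beta sets, cores and symplectic partitions *)

(** In a weakly decreasing list the zeros come last, where they agree with the default value of
    [nth]. *)
Lemma nth_filter_pos u i : sorted geq u -> nth 0%N [seq x <- u | (0 < x)%N] i = nth 0%N u i.
Proof.
elim: u i => [|x u IH] i //= up; have := path_sorted up => /IH {}IH.
case: posnP => [x0|_]; last by case: i.
have u0 : all (geq x) u.
  by apply: (order_path_min _ up) => a b c /= ba /leq_trans; apply.
case: (ltnP i (size (x :: u))) => [lt|ge]; last first.
  rewrite !nth_default //; apply: leq_trans ge; rewrite size_filter /=.
  exact: leqW (count_size _ _).
rewrite (_ : filter _ _ = [::]).
  rewrite nth_nil; have : nth 0%N (x :: u) i \in x :: u by apply: mem_nth.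
  by rewrite inE => /predU1P[->//|/(allP u0)] /=; rewrite x0 leqn0 => /eqP->.
apply/eqP; rewrite -size_eq0 size_filter -leqn0 leqNgt -has_count.
by apply/hasPn => y /(allP u0) /=; rewrite x0 leqn0 => /eqP->.
Qed.

Section Unbeta.

Variable s : seq nat.
Hypothesis s_sorted : sorted gtn s.

Let u := [seq (nth 0 s i - (size s - i.+1))%N | i <- iota 0 (size s)].

(** This makes the truncated subtraction in [unbeta] exact. *)
Lemma gtn_sorted_ge i : (i < size s)%N -> (size s - i.+1 <= nth 0 s i)%N.
Proof.
move=> lt; have [k] := ubnP (size s - i); elim: k i lt => // k IH i lt lek.
have [lt1|ge1] := ltnP i.+1 (size s); last by rewrite (_ : (_ - _)%N = 0%N) //; lia.
have := IH i.+1 lt1; have /(sortedP 0%N)/(_ i lt1) := s_sorted; rewrite /=; lia.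
Qed.

Let u_sorted : sorted geq u.
Proof.
apply/(sortedP 0%N) => i; rewrite size_map size_iota => lt.
rewrite !(nth_map 0%N) ?size_iota ?nth_iota //; try lia.
have /(sortedP 0%N)/(_ i lt) := s_sorted; rewrite /=.
have := gtn_sorted_ge lt; rewrite !add0n; lia.
Qed.

Lemma unbeta_part : is_part (unbeta s).
Proof.
apply/andP; split; last by rewrite mem_filter ltnn.
by apply: sorted_filter u_sorted => a b c /= ba /leq_trans; apply.
Qed.

Lemma size_unbeta : (size (unbeta s) <= size s)%N.
Proof. by rewrite size_filter (leq_trans (count_size _ _)) ?size_map ?size_iota. Qed.

Lemma part_unbeta i : (i < size s)%N ->
  (part (unbeta s) i + (size s - i.+1))%N = nth 0%N s i.
Proof.
move=> lt; rewrite /part nth_filter_pos // (nth_map 0%N) ?size_iota //.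
by rewrite nth_iota // add0n subnK // gtn_sorted_ge.
Qed.

Lemma beta_unbeta : beta (size s) (unbeta s) = s.
Proof.
apply: (@eq_from_nth _ 0%N) => [|i]; rewrite size_beta // => lt.
by rewrite nth_beta // part_unbeta.
Qed.

End Unbeta.

Lemma count_iota_lt (p : pred nat) n i : (forall j k, (j <= k)%N -> p k -> p j) ->
  (i < count p (iota 0 n))%N = (i < n)%N && p i.
Proof.
move=> pd; elim: n => [|n IH] //; rewrite -[n.+1]addn1 iotaD count_cat /= addn0 add0n.
case: (boolP (p n)) => pn.
  rewrite (_ : count p (iota 0 n) = n).
    by rewrite addn1; case: ltnP => //= le; rewrite (pd i n).
  rewrite -[RHS](size_iota 0 n); apply/eqP; rewrite -all_count; apply/allP => j.
  by rewrite mem_iota => /andP[_ lt]; apply: pd pn; apply: ltnW.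
rewrite addn0 IH addn1 ltnS [(i <= n)%N]leq_eqVlt.
by case: eqP => [->|] //=; rewrite (negPf pn) andbF.
Qed.

(** Both sides say that row [j] and column [i] meet in a cell of the diagram. *)
Lemma lt_colen lam i j : is_part lam -> (j < colen lam i)%N = (i < part lam j)%N.
Proof.
move=> lp; rewrite /colen -{1}(mkseq_nth 0%N lam) /mkseq count_map count_iota_lt.
  by case: ltnP => //= ge; rewrite /part nth_default.
by move=> a b ab /= /leq_trans; apply; apply: part_geq.
Qed.

Lemma lt_frob_rank lam i : is_part lam -> (i < frob_rank lam)%N = (i < part lam i)%N.
Proof.
move=> lp; rewrite /frob_rank count_iota_lt.
  by case: ltnP => //= ge; rewrite /part nth_default.
by move=> a b ab; have := part_geq lp ab; lia.
Qed.

(** If the number were the beta number of row j, then lam_j - i = j + 1 - [colen lam i], and exactly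
    one of the equivalent conditions i < lam_j and j < [colen lam i] would hold. *)
Lemma gap_beta N lam i : is_part lam -> (colen lam i <= N)%N ->
  (N + i - colen lam i)%N \notin beta N lam.
Proof.
move=> lp le; apply/(nthP 0%N) => -[j]; rewrite size_beta => lj; rewrite nth_beta // => e.
by have := lt_colen i j lp; lia.
Qed.

Lemma colen_size lam i : (colen lam i <= size lam)%N.
Proof. exact: count_size. Qed.

(** The beta number lam_i + N - i - 1 reaches [N] exactly when i < lam_i. *)
Lemma count_geq_beta N lam : is_part lam -> (size lam <= N)%N ->
  count (leq N) (beta N lam) = frob_rank lam.
Proof.
move=> lp sz; rewrite count_map /frob_rank.
have -> : iota 0 N = iota 0 (size lam) ++ iota (size lam) (N - size lam).
  by rewrite -{2}[size lam]add0n -iotaD subnKC.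
rewrite count_cat.
rewrite [X in (_ + X)%N](_ : _ = 0%N); last first.
  apply/eqP; rewrite -leqn0 leqNgt -has_count; apply/hasPn => i; rewrite mem_iota => h /=.
  by rewrite /part nth_default; lia.
rewrite addn0; apply: eq_in_count => i; rewrite mem_iota /=; lia.
Qed.

Lemma ltn_sorted_mkseq f n : (forall i, (i.+1 < n)%N -> (f i < f i.+1)%N) ->
  sorted ltn (mkseq f n).
Proof.
move=> H; apply/(sortedP 0%N) => i; rewrite size_mkseq => lt.
by rewrite !nth_mkseq; [apply: H|lia..].
Qed.

(* Each of the rk gaps of the beta set below N lies at N + i - colen lam i for
   some i < rk; being symplectic says that these are the reflections in N - 1 of
   the elements of the beta set that are at least N. *)
Lemma symplectic_beta N lam : is_part lam -> (size lam <= N)%N ->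
  part_symplectic lam <->
  (forall x, x \in beta N lam -> (N <= x)%N ->
     (x.+2 <= N + N)%N /\ (N + N - x.+2)%N \notin beta N lam).
Proof.
move=> lp sz; set d := frob_rank lam.
have sE : part_symplectic lam <-> (forall i, (i < d)%N -> colen lam i = (part lam i).+1).
  have b i : (i < d)%N -> (frob_b lam i == (frob_a lam i).+1) = (colen lam i == (part lam i).+1).
    rewrite lt_frob_rank // => lt; rewrite /frob_b /frob_a part_conj //.
    by have := lt_colen i i lp; lia.
  split=> [/allP H i lt|H].
    by apply/eqP; rewrite -b //; apply: H; rewrite mem_iota.
  by apply/allP=> i; rewrite mem_iota => /andP[_ lt]; rewrite b ?H.
have dN : (d <= N)%N.
  by rewrite /d -(count_geq_beta lp sz) (leq_trans (count_size _ _)) ?size_beta.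
have cN i : (colen lam i <= N)%N := leq_trans (colen_size lam i) sz.
rewrite sE; split=> [H x /(nthP 0%N)[i]|H].
  rewrite size_beta => li; rewrite nth_beta // => <- ge.
  have id : (i < d)%N by rewrite lt_frob_rank //; lia.
  have := cN i; have := H i id => e le; split; first lia.
  by rewrite (_ : (N + N - _)%N = (N + i - colen lam i)%N) ?gap_beta //; lia.
pose G := [seq y <- iota 0 N | y \notin beta N lam].
have Gs : sorted ltn G by apply: sorted_filter (iota_ltn_sorted 0 N); apply: ltn_trans.
(* The beta set has [N] elements, so it misses as many numbers below [N] as it has elements from [N]
   on. *)
have szG : size G = d.
  apply: (@addnI (count [in beta N lam] (iota 0 N))).
  rewrite size_filter count_predC size_iota.
  have := count_predC (leq N) (beta N lam); rewrite size_beta count_geq_beta // => {1}<-.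
  rewrite addnC; congr (_ + _)%N; rewrite -!size_filter; apply: perm_size; apply: uniq_perm.
  - by rewrite filter_uniq ?beta_uniq.
  - by rewrite filter_uniq ?iota_uniq.
  by move=> y; rewrite !mem_filter mem_iota /= -ltnNge andbC.
(* A strictly increasing sequence of [d] gaps lists all of [G]. Hence the gaps given by column
   lengths and the reflected beta numbers agree index by index. *)
have eqG f : (forall i, (i.+1 < d)%N -> (f i < f i.+1)%N) ->
    (forall i, (i < d)%N -> f i \in G) -> mkseq f d = G.
  move=> fi fG; have fs := ltn_sorted_mkseq fi.
  apply: (irr_sorted_eq ltn_trans ltnn fs Gs).
  have us := sorted_uniq ltn_trans ltnn fs.
  have sub : {subset mkseq f d <= G}.
    by move=> y /mapP[i]; rewrite mem_iota => /andP[_ lt] ->; apply: fG.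
  by case: (uniq_min_size us sub); rewrite ?szG ?size_mkseq.
have e1 : mkseq (fun i => N + i - colen lam i)%N d = G.
  apply: eqG => i lt; first by have := leq_colen lam (leqnSn i); have := cN i; lia.
  have := lt; rewrite lt_frob_rank // -(lt_colen _ _ lp) => lc.
  rewrite mem_filter gap_beta // mem_iota /=; have := cN i; lia.
have inb i : (i < d)%N -> nth 0%N (beta N lam) i \in beta N lam.
  by move=> lt; apply: mem_nth; rewrite size_beta; lia.
have geN i : (i < d)%N -> (N <= nth 0%N (beta N lam) i)%N.
  by move=> lt; rewrite nth_beta; last lia; rewrite lt_frob_rank // in lt; lia.
have e2 : mkseq (fun i => N + N - (nth 0%N (beta N lam) i).+2)%N d = G.
  apply: eqG => i lt.
    have id := ltnW lt; have [le _] := H _ (inb i id) (geN i id).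
    move: le; rewrite !nth_beta; try lia.
    by have := part_geq lp (leqnSn i); lia.
  have [le no] := H _ (inb i lt) (geN i lt).
  by rewrite mem_filter no mem_iota /=; have := geN i lt; lia.
move=> i lt; have iN : (i < N)%N by apply: leq_trans lt dN.
have ei : (N + i - colen lam i = N + N - (nth 0 (beta N lam) i).+2)%N.
  by have := congr1 (fun s => nth 0%N s i) (etrans e1 (esym e2)); rewrite !nth_mkseq.
have [le _] := H _ (inb i lt) (geN i lt); have cle := cN i.
have ilam : (i < part lam i)%N by rewrite -lt_frob_rank.
have icol : (i < colen lam i)%N by rewrite lt_colen.
by move: ei le; rewrite (nth_beta lam iN); lia.
Qed.

Lemma sum_count_mod t s : (0 < t)%N ->
  (\sum_(0 <= r < t) count (fun x => x %% t == r)%N s)%N = size s.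
Proof.
move=> t0; elim: s => [|x s IH] /=; first by rewrite big1.
rewrite big_split /= IH -add1n; congr (_ + _)%N.
rewrite (bigD1_seq (x %% t)%N) ?iota_uniq ?mem_index_iota ?ltn_pmod //= eqxx.
by rewrite big1 // => r /negPf; rewrite eq_sym => ->.
Qed.

(** * The abacus of the core and its reflection symmetry *)

Section Core.

Variables (t n : nat) (m : nat -> nat).
Hypotheses (t_gt1 : (1 < t)%N) (n_gt0 : (0 < n)%N).
Hypothesis sum_m : (\sum_(0 <= r < t) m r = n * t)%N.

(** The beta set of the core, not yet sorted: the [m r] beads of runner [r] occupy its first
    positions. *)
Definition core_runners : seq nat :=
  [seq (k * t + r)%N | r <- iota 0 t, k <- iota 0 (m r)].

Lemma mem_core_runners x : (x \in core_runners) = (x %/ t < m (x %% t))%N.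
Proof.
have t0 : (0 < t)%N by lia.
apply/allpairsPdep/idP => [[r [k []]]|lt].
  rewrite !mem_iota !add0n => /andP[_ lr] /andP[_ lk] ->.
  by rewrite divnMDl // divn_small // addn0 modnMDl modn_small.
exists (x %% t)%N, (x %/ t)%N.
by rewrite !mem_iota !add0n ltn_pmod // -divn_eq.
Qed.

Lemma core_runners_uniq : uniq core_runners.
Proof.
apply: allpairs_uniq_dep => [|r _|]; rewrite ?iota_uniq //.
move=> [r k] [r' k'] /allpairsPdep[r1 [k1 [+ _ ->]]] /allpairsPdep[r2 [k2 [+ _ ->]]] /=.
rewrite !mem_iota !add0n => /andP[_ l1] /andP[_ l2] e.
have er : r1 = r2.
  by have := congr1 (modn^~ t) e; rewrite /= !modnMDl !modn_small.
subst r2; congr existT; apply/eqP.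
by move/eqP: e; rewrite eqn_add2r eqn_pmul2r //; lia.
Qed.

Lemma count_core_runners (p : pred nat) :
  count p core_runners = (\sum_(0 <= r < t) count (fun k => p (k * t + r)%N) (iota 0 (m r)))%N.
Proof.
rewrite /core_runners /allpairs_dep count_flatten sumnE !big_map -/(index_iota _ _).
by rewrite /index_iota subn0; apply: eq_bigr => r _; rewrite count_map.
Qed.

Lemma size_core_runners : size core_runners = (n * t)%N.
Proof.
rewrite -count_predT count_core_runners -sum_m; apply: eq_bigr => r _.
by rewrite count_predT size_iota.
Qed.

Let core := unbeta (sort geq core_runners).

Let sorted_core : sorted gtn (sort geq core_runners).
Proof.
have := sort_sorted (fun a b => leq_total b a) core_runners.
rewrite sorted_pairwise; last by move=> a b c /= ba /leq_trans; apply.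
have := core_runners_uniq; rewrite -(sort_uniq geq) uniq_pairwise => us ss.
rewrite sorted_pairwise; last by move=> a b c /= ba ca; apply: ltn_trans ca ba.
have : pairwise [rel x y | (x != y) && geq x y] (sort geq core_runners).
  by rewrite pairwise_relI; apply/andP.
by apply: sub_pairwise => x y /=; lia.
Qed.

Let szs : size (sort geq core_runners) = (n * t)%N.
Proof. by rewrite size_sort size_core_runners. Qed.

Let beta_core : beta (n * t) core = sort geq core_runners.
Proof. by rewrite -szs beta_unbeta. Qed.

Let core_part : is_part core.
Proof. exact: unbeta_part. Qed.

Let core_size : (size core <= n * t)%N.
Proof. by rewrite -szs size_unbeta. Qed.

(** The rank counts the beads from [n * t] on, which are those at position [n] or later on their
    runner. The subtraction is truncated on purpose. *)
Lemma frob_rank_core : frob_rank core = (\sum_(0 <= r < t) (m r - n))%N.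
Proof.
rewrite -(count_geq_beta core_part core_size) beta_core.
have /seq.permP-> : perm_eq (sort geq core_runners) core_runners by rewrite perm_sort.
rewrite count_core_runners; apply: eq_big_nat => r /andP[_ lr].
have E : count (fun k => n <= k)%N (iota 0 (m r)) = (m r - n)%N.
  elim: (m r) => [|k IH] //; rewrite -[k.+1]addn1 iotaD count_cat IH /= addn0; lia.
rewrite -E; apply: eq_count => k /=; apply/idP/idP => h; last by nia.
by rewrite leqNgt; apply/negP => kn; nia.
Qed.

(** The reflection x -> 2nt - 2 - x sends position k of runner r to position 2n - 1 - k of runner t
    - 2 - r, and on runner t - 1 it sends k to 2n - 2 - k. The criterion of [symplectic_beta] gives
    only upper bounds on the multiplicities; their total [n * t] turns these into equalities. *)
Lemma symplectic_core : part_symplectic core <->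
  (forall r, (r <= t - 2)%N -> m r + m (t - 2 - r) = n + n)%N /\ m t.-1 = n.
Proof.
have n1t : (n * t = (n - 1) * t + t)%N by nia.
rewrite (symplectic_beta core_part core_size) beta_core.
have -> : (forall x, x \in sort geq core_runners -> (n * t <= x)%N ->
     (x.+2 <= n * t + n * t)%N /\ (n * t + n * t - x.+2)%N \notin sort geq core_runners) <->
   (forall k r, (r < t)%N -> (k < m r)%N -> (n <= k)%N ->
     ((k * t + r).+2 <= n * t + n * t)%N /\ (n * t + n * t - (k * t + r).+2)%N \notin core_runners).
  split=> H => [k r lr lk nk|x].
    have := H (k * t + r)%N; rewrite !mem_sort mem_core_runners.
    rewrite divnMDl ?divn_small ?addn0 ?modnMDl ?modn_small //; last lia.
    by apply=> //; nia.
  rewrite !mem_sort mem_core_runners => lt ge; have := H (x %/ t)%N (x %% t)%N.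
  rewrite -divn_eq ltn_pmod; last lia.
  by apply=> //; rewrite leq_divRL //; lia.
have dm q r : (r < t)%N -> ((q * t + r)%N \in core_runners) = (q < m r)%N.
  move=> lr; rewrite mem_core_runners divnMDl ?divn_small ?addn0 ?modnMDl ?modn_small //; lia.
split=> [H|[H Ht] k r lr lk nk].
  have le1 r : (r <= t - 2)%N -> (n < m r)%N -> (m r + m (t - 2 - r) <= n + n)%N.
    (* The last bead of runner r is reflected to position 2n - m_r of runner t - 2 - r, which must
       be free. *)
    move=> lr lt; have [||| le] := H (m r).-1 r; [lia..|].
    have mle : (m r <= n + n)%N by nia.
    rewrite (_ : (_ - _)%N = (n + n - m r) * t + (t - 2 - r))%N; last by nia.
    by rewrite dm; lia.
  have le2 r : (r <= t - 2)%N -> (m r + m (t - 2 - r) <= n + n)%N.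
    move=> lr; have h1 := le1 r lr; have h2 := le1 (t - 2 - r)%N (leq_subr _ _).
    by rewrite subKn // in h2; lia.
  have le3 : (m t.-1 <= n)%N.
    (* A bead at position n of the last runner would be reflected to position n - 2 of the same
       runner, which is occupied. *)
    rewrite leqNgt; apply/negP => lt; have [||| le] := H n t.-1; [lia..|].
    have n2 : (1 < n)%N by nia.
    rewrite (_ : (_ - _)%N = (n - 2) * t + t.-1)%N; last by nia.
    by rewrite dm; lia.
  have s1 : (\sum_(0 <= r < t.-1) m r + m t.-1 = n * t)%N.
    by rewrite -sum_m -big_nat_recr //= prednK //; lia.
  have s2 : (\sum_(0 <= r < t.-1) m (t - 2 - r) = \sum_(0 <= r < t.-1) m r)%N.
    by rewrite [RHS]big_nat_rev /=; apply: eq_big_nat => r lr; congr m; lia.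
  (* With the total of the [m r], the deficits add up to 2(m_(t-1) - n), which is at most 0; so they
     vanish and m_(t-1) = n. *)
  have s3 : (\sum_(0 <= r < t.-1) (m r + m (t - 2 - r)) +
             \sum_(0 <= r < t.-1) (n + n - (m r + m (t - 2 - r))) = t.-1 * (n + n))%N.
    rewrite -big_split /= -[t.-1 in RHS]subn0 -sum_nat_const_nat.
    by apply: eq_big_nat => r lr; have := le2 r; lia.
  rewrite big_split /= s2 in s3.
  have et : m t.-1 = n by nia.
  have : (\sum_(0 <= r < t.-1) (n + n - (m r + m (t - 2 - r))) == 0)%N by nia.
  rewrite sum_nat_seq_eq0 => /allP H0; split=> // r lr.
  have /H0/eqP : r \in index_iota 0 t.-1 by rewrite mem_index_iota; lia.
  by have := le2 r lr; lia.
have rt : (r <= t - 2)%N.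
  have [e|ne] := eqVneq r t.-1; last lia.
  by rewrite e Ht in lk; lia.
have e := H r rt; have kn : (k.+1 <= n + n)%N by lia.
split; first by nia.
rewrite (_ : (_ - _)%N = (n + n - k.+1) * t + (t - 2 - r))%N; last by nia.
by rewrite dm; lia.
Qed.

End Core.

(** * The twisted determinant *)

Lemma sp_detE N lam : (0 < N)%N -> (size lam <= N)%N -> sp_det N lam = sp lam.
Proof.
move=> N0; rewrite leq_eqVlt => /predU1P[e|lt].
  by rewrite /sp -sp_detS ?e.
rewrite -(subnKC lt) /sp; elim: (N - _)%N => [|k IH]; first by rewrite addn0.
by rewrite addnS sp_detS ?IH //; lia.
Qed.

Lemma so_detE N lam : (size lam <= N)%N -> so_det N lam = so lam.
Proof.
move=> le; rewrite -(subnKC le) /so; elim: (N - _)%N => [|k IH]; first by rewrite addn0.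
by rewrite addnS so_detS ?IH //; lia.
Qed.

(** A ring morphism commutes with integer multiples, and multiplication by [k.+1] is invertible;
    this lets the factor 1/2 of [sp] pass through [phi]. *)
Lemma rmorph_scale_inv (phi : {rmorphism symfun -> symfun}) (x : symfun) k :
  phi ((k.+1%:R : rat)^-1 *: x) = (k.+1%:R : rat)^-1 *: phi x.
Proof.
have k0 : (k.+1%:R : rat) != 0 by rewrite Num.Theory.pnatr_eq0.
rewrite -[x in RHS](scalerKV k0) scaler_nat rmorphMn /= -scaler_nat scalerK //.
Qed.

Lemma beta_sorted N lam : is_part lam -> sorted gtn (beta N lam).
Proof.
move=> lp; apply/(sortedP 0%N) => i; rewrite size_beta => lt /=.
by rewrite !nth_beta //; [have := part_geq lp (leqnSn i); lia|lia].
Qed.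

Lemma count_iota_mod t n r : (r < t)%N ->
  count (fun j => j %% t == r)%N (iota 0 (n * t)) = n.
Proof.
move=> lt; elim: n => [|n IH] //.
rewrite mulSn addnC iotaD count_cat IH add0n -[X in iota X]addn0 iotaDl count_map.
rewrite (_ : count _ _ = count (pred1 r) (iota 0 t)).
  by rewrite count_uniq_mem ?iota_uniq // mem_iota /= lt addn1.
by apply: eq_in_count => j; rewrite mem_iota => /andP[_ lj] /=; rewrite modnMDl modn_small.
Qed.

Section Twist.

Variables (t n : nat) (lam : seq nat) (phi : {rmorphism symfun -> symfun}).
Hypotheses (t_gt1 : (1 < t)%N) (n_gt0 : (0 < n)%N).
Hypotheses (lam_part : is_part lam) (lam_size : (size lam <= n * t)%N).
Hypothesis phi_hsym : forall r : nat,
  phi (hsym r) = if (t %| r)%N then hsym (r %/ t) else 0.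

Local Notation N := (n * t)%N.
Local Notation m := (beta_mult t N lam).
Local Notation quot := (tquot t N lam).

Lemma phi_hsymz (z : int) (d : nat) : (d < t)%N ->
  phi (hsymz (z * t%:Z + d%:Z)) = if d == 0%N then hsymz z else 0.
Proof.
move=> lt; case: z => k.
  rewrite -PoszM -PoszD /= phi_hsym /dvdn modnMDl modn_small //.
  by case: eqP => [->|//]; rewrite addn0 mulnK //; lia.
(* For negative [z] the whole index is negative because [d < t]. *)
rewrite hsymzN ?rmorph0; first by case: eqP.
have : (Negz k * t%:Z <= - t%:Z)%R by nia.
by lia.
Qed.

(** The image under [phi] of the entry of the [sp] determinant in the row with beta number [x]:
    there x + 1 - N = lam_i - i. *)
Definition twisted (x j : nat) : symfun :=
  phi (hsymz (x%:Z + 1 - N%:Z + j%:Z)) + phi (hsymz (x%:Z + 1 - N%:Z - j%:Z)).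

(** An index survives when [t] divides it. The sum r + 1 + c lies between 1 and 2t - 1, so it must
    be t; the difference r + 1 - c must be 0, or t in the single case r = t - 1, c = 0. *)
Lemma twistedE u r k c : (r < t)%N -> (c < t)%N ->
  twisted (u * t + r) (k * t + c) =
    (if (r.+1 + c == t)%N then hsymz (u%:Z + k%:Z + 1 - n%:Z) else 0)
  + (if r.+1 == c then hsymz (u%:Z - k%:Z - n%:Z)
     else if (r.+1 == t) && (c == 0%N) then hsymz (u%:Z + 1 - k%:Z - n%:Z) else 0).
Proof.
move=> lr lc; rewrite /twisted; congr (_ + _).
  have [e|gt|lt] := ltngtP (r.+1 + c)%N t.
  - rewrite (_ : _ + _ = (u%:Z + k%:Z - n%:Z) * t%:Z + (r.+1 + c)%N%:Z); last by lia.
    by rewrite phi_hsymz.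
  - rewrite (_ : _ + _ = (u%:Z + k%:Z + 1 - n%:Z) * t%:Z + (r.+1 + c - t)%N%:Z); last by lia.
    by rewrite phi_hsymz; [case: eqP => //|]; lia.
  rewrite (_ : _ + _ = (u%:Z + k%:Z + 1 - n%:Z) * t%:Z + 0%N%:Z); last by lia.
  by rewrite phi_hsymz //; lia.
have [lt|gt|e] := ltngtP r.+1 c.
- rewrite (_ : _ - _ = (u%:Z - k%:Z - n%:Z - 1) * t%:Z + (t + r.+1 - c)%N%:Z); last by lia.
  rewrite phi_hsymz; last lia.
  by rewrite [c == 0%N](_ : _ = false) ?andbF; [case: eqP => //|]; lia.
- case: eqP => [et|ne] /=.
    case: eqP => [ec|nc].
      rewrite (_ : _ - _ = (u%:Z + 1 - k%:Z - n%:Z) * t%:Z + 0%N%:Z); last by lia.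
      by rewrite phi_hsymz //; lia.
    rewrite (_ : _ - _ = (u%:Z - k%:Z - n%:Z) * t%:Z + (r.+1 - c)%N%:Z); last by lia.
    by rewrite phi_hsymz; [case: eqP => //|]; lia.
  rewrite (_ : _ - _ = (u%:Z - k%:Z - n%:Z) * t%:Z + (r.+1 - c)%N%:Z); last by lia.
  by rewrite phi_hsymz; [case: eqP => //|]; lia.
rewrite (_ : _ - _ = (u%:Z - k%:Z - n%:Z) * t%:Z + 0%N%:Z); last by lia.
by rewrite phi_hsymz //; lia.
Qed.

Lemma twisted_eq0 x j : (x %% t).+1 != (j %% t)%N -> ((x %% t).+1 + j %% t != t)%N ->
  twisted x j = 0.
Proof.
have t0 : (0 < t)%N by lia.
move=> n1 n2; rewrite (divn_eq x t) (divn_eq j t) twistedE ?ltn_pmod //.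
rewrite (negPf n1) (negPf n2) add0r; case: eqP => //= e.
by case: eqP => // e0; rewrite e e0 addn0 eqxx in n2.
Qed.

Definition row_class (r : nat) : seq nat := [seq x <- beta N lam | (x %% t == r)%N].

Lemma size_row_class r : size (row_class r) = m r.
Proof. by rewrite size_filter. Qed.

Lemma beta_class_sorted r : sorted gtn (beta_class t N lam r).
Proof.
have gt_trans : transitive gtn by move=> a b c /= ba ca; apply: ltn_trans ca ba.
have := sorted_filter gt_trans (fun x => x %% t == r)%N (beta_sorted N lam_part).
rewrite /beta_class; set s := filter _ _ => ss.
have sm : all (fun x => x %% t == r)%N s by apply: filter_all.
rewrite sorted_map; apply: (sub_in_sorted (P := fun x => x %% t == r)%N) sm ss.
move=> x y /eqP xr /eqP yr /= lt; rewrite ltnNge; apply/negP => le.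
move: lt; rewrite (divn_eq x t) (divn_eq y t) xr yr ltn_add2r ltn_mul2r => /andP[_].
by rewrite ltnNge le.
Qed.

Lemma size_beta_class r : size (beta_class t N lam r) = m r.
Proof. by rewrite size_map size_row_class. Qed.

Lemma quot_part r : is_part (quot r).
Proof. exact: unbeta_part (beta_class_sorted r). Qed.

Lemma size_quot r : (size (quot r) <= m r)%N.
Proof. by rewrite -size_beta_class size_unbeta. Qed.

Lemma nth_row_class r i : (i < m r)%N ->
  nth 0%N (row_class r) i = ((part (quot r) i + (m r - i.+1)) * t + r)%N.
Proof.
move=> lt; have := part_unbeta (beta_class_sorted r); rewrite size_beta_class => -> //.
rewrite (nth_map 0%N) ?size_row_class //.
have : nth 0%N (row_class r) i \in row_class r by rewrite mem_nth ?size_row_class.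
by rewrite mem_filter => /andP[/eqP e _]; rewrite [LHS](divn_eq _ t) e.
Qed.

Lemma size_residue_class r : size (residue_class t n r) = n.
Proof. by rewrite size_map size_iota. Qed.

Lemma nth_residue_class r k : (k < n)%N -> nth 0%N (residue_class t n r) k = (k * t + r)%N.
Proof. by move=> lt; rewrite (nth_map 0%N) ?size_iota // nth_iota. Qed.

Lemma sum_mult : (\sum_(0 <= r < t) m r = N)%N.
Proof. by rewrite sum_count_mod ?size_beta //; lia. Qed.

Lemma phi_sp : phi (sp lam) = (2%:R : rat)^-1 *: dets 0%N 0%N twisted (beta N lam) (iota 0 N).
Proof.
rewrite -(@sp_detE N) //; last by rewrite muln_gt0 n_gt0; lia.
rewrite /sp_det rmorph_scale_inv -det_map_mx; congr (_ *: _).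
rewrite (detsE (n := N) (g := fun i j => phi (hsymz ((part lam i)%:Z - i%:Z + j%:Z)
    + hsymz ((part lam i)%:Z - i%:Z - j%:Z)))) ?size_beta // => [|i j li lj].
  by congr (\det _); apply/matrixP => i j; rewrite !mxE.
rewrite nth_beta // nth_iota // /twisted [RHS]rmorphD.
by congr (_ + _); congr (phi (hsymz _)); lia.
Qed.

(** By [dets_classes], coupled classes have as many rows as columns: residue t - 1 faces the n
    columns of residue 0, and residues r and t - 2 - r together face the columns of residues r + 1
    and t - 1 - r. *)
Lemma twisted_balanced :
  dets 0%N 0%N twisted (beta N lam) (iota 0 N) != 0 ->
  (forall r, (r <= t - 2)%N -> (m r + m (t - 2 - r) = n + n)%N) /\ m t.-1 = n.
Proof.
have t0 : (0 < t)%N by lia.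
move=> nz; have nzE i j : twisted i j != 0 ->
    ((i %% t).+1 == j %% t)%N || ((i %% t).+1 + j %% t == t)%N.
  by apply: contraR; rewrite negb_or => /andP[n1 n2]; rewrite twisted_eq0.
have E (p q : pred nat) : (forall i j, twisted i j != 0 -> p i = q j) ->
    count p (beta N lam) = count q (iota 0 N).
  by move=> H; apply: (dets_classes _ nz); rewrite ?size_beta ?size_iota // => *; apply: H.
split=> [r lr|]; last first.
  rewrite /beta_mult (E _ (fun j => j %% t == 0)%N) ?count_iota_mod // => i j /nzE.
  have := ltn_pmod i t0; have := ltn_pmod j t0; lia.
(* A self-paired residue faces only the n columns of residue r + 1. *)
have [e|ne] := eqVneq r (t - 2 - r)%N.
  rewrite -e /beta_mult (E _ (fun j => j %% t == r.+1)%N); last first.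
    by move=> i j /nzE; have := ltn_pmod i t0; have := ltn_pmod j t0; lia.
  by rewrite count_iota_mod //; lia.
have U (f g : pred nat) s : (forall x, ~~ (f x && g x)) ->
    (count f s + count g s = count (fun x => f x || g x) s)%N.
  move=> H; rewrite -count_predUI [X in (_ + X)%N](_ : _ = 0%N) ?addn0 //.
  by apply/eqP; rewrite -leqn0 leqNgt -has_count; apply/hasPn => x _; apply: H.
rewrite /beta_mult U; last by move=> x; lia.
rewrite (E _ (fun j => (j %% t == r.+1)%N || (j %% t == t - 1 - r)%N)); last first.
  by move=> i j /nzE; have := ltn_pmod i t0; have := ltn_pmod j t0; lia.
rewrite -U; last by move=> x; lia.
by rewrite !count_iota_mod //; lia.
Qed.

(** Both lists are sorted for the strict order [residue_lt] and have the same elements. *)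
Lemma row_class_flatten :
  [seq nth 0%N (beta N lam) (residue_sort t N lam i) | i <- enum 'I_N]
  = flatten (map row_class (iota 0 t)).
Proof.
have t0 : (0 < t)%N by lia.
apply: (irr_sorted_eq (@residue_lt_trans t) (residue_lt_irr t)).
- exact: residue_sortP.
- rewrite sorted_pairwise; last exact: residue_lt_trans.
  suff H l j : pairwise (residue_lt t) (flatten (map row_class (iota j l))) by apply: H.
  elim: l j => [|l IH] j //=.
  rewrite pairwise_cat IH andbT; apply/andP; split.
    apply/allrelP => x y; rewrite mem_filter => /andP[/eqP xj _] /flattenP[_ /mapP[r + ->]].
    rewrite mem_iota mem_filter => lr /andP[/eqP yr _].
    by rewrite /residue_lt xj yr; case: ltnP => //; lia.
  have gt_trans : transitive gtn by move=> a b c /= ba ca; apply: ltn_trans ca ba.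
  have := sorted_filter gt_trans (fun x => x %% t == j)%N (beta_sorted N lam_part).
  rewrite -/(row_class j) sorted_pairwise // => pw.
  apply: (sub_in_pairwise (P := fun x => x %% t == j)%N) (filter_all _ _) pw.
  by move=> x y /eqP xj /eqP yj /= lt; rewrite /residue_lt xj yj eqxx lt orbT.
move=> x; rewrite (perm_mem (beta_permE lam _)); apply/idP/flattenP => [xb|[_ /mapP[r _ ->]]].
  exists (row_class (x %% t)%N); last by rewrite mem_filter eqxx.
  by apply: map_f; rewrite mem_iota ltn_pmod.
by rewrite mem_filter => /andP[].
Qed.

Lemma dets_beta c : dets 0%N 0%N twisted (beta N lam) c =
  (-1) ^+ odd_perm (residue_sort t N lam)
  * dets 0%N 0%N twisted (flatten (map row_class (iota 0 t))) c.
Proof.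
rewrite -row_class_flatten; set w := residue_sort t N lam.
rewrite (detsE (n := N) (g := fun i j => twisted (nth 0%N (beta N lam) i) (nth 0%N c j)))
  ?size_beta //.
set A := \matrix_(i, j) _.
have -> : dets 0%N 0%N twisted [seq nth 0%N (beta N lam) (w i) | i <- enum 'I_N] c =
    \det (row_perm w A).
  have sE : size [seq nth 0%N (beta N lam) (w i) | i <- enum 'I_N] = N.
    by rewrite size_map size_enum_ord.
  move: sE; set s := map _ _ => sE.
  rewrite (detsE (n := N) (g := fun i j => twisted (nth 0%N s i) (nth 0%N c j))) //.
  congr (\det _); apply/matrixP => i j; rewrite !mxE; congr (twisted _ _).
  by rewrite /s (nth_map i) ?size_enum_ord // nth_ord_enum.
by rewrite row_permE det_mulmx det_perm mulrA -signr_addb addbb mul1r.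
Qed.

(** Both terms survive, with indices mu_i - i + j and mu_i - i - j for the quotient component mu, so
    the [sp] shape reappears and takes up the factor 1/2. *)
Lemma sp_block : m t.-1 = n ->
  (2%:R : rat)^-1 *: dets 0%N 0%N twisted (row_class t.-1) (residue_class t n 0) = sp (quot t.-1).
Proof.
move=> e; rewrite -(@sp_detE n) //; last by rewrite (leq_trans (size_quot _)) ?e.
congr (_ *: _); apply: (detsE (g := fun i j =>
  hsymz ((part (quot t.-1) i)%:Z - i%:Z + j%:Z) + hsymz ((part (quot t.-1) i)%:Z - i%:Z - j%:Z))).
  by rewrite size_row_class.
move=> i j li lj; rewrite nth_row_class ?e // nth_residue_class //.
rewrite twistedE; [|lia..]; rewrite addn0 prednK; last lia.
rewrite eqxx [t == 0%N](_ : _ = false) /=; last lia.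
by congr (hsymz _ + hsymz _); lia.
Qed.

(** Here r + 1 = t/2 is both the residue of the columns and its own negative mod t; the two indices
    are mu_i - i + j and mu_i - i - j - 1. *)
Lemma so_block : ~~ odd t -> m (t - 2)./2 = n ->
  dets 0%N 0%N twisted (row_class (t - 2)./2) (residue_class t n (t - 2)./2.+1)
  = so (quot (t - 2)./2).
Proof.
move=> ev e; rewrite -(@so_detE n) //; last by rewrite (leq_trans (size_quot _)) ?e.
set r := (t - 2)./2; have er : (r.+1 + r.+1 = t)%N by rewrite /r; lia.
apply: (detsE (g := fun i j =>
  hsymz ((part (quot r) i)%:Z - i%:Z + j%:Z) + hsymz ((part (quot r) i)%:Z - i%:Z - j%:Z - 1))).
  by rewrite size_row_class.
move=> i j li lj; rewrite nth_row_class ?e // nth_residue_class //.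
rewrite twistedE; [|lia..]; rewrite er !eqxx.
by congr (hsymz _ + hsymz _); lia.
Qed.

(** Since a + b = 2n, the columns of residue r + 1 correspond to q from n - 1 - b down to -b, and
    those of residue r' + 1 to the next n values upwards. Reversing the first n columns gives the
    matrix of [rs_det]. *)
Lemma rs_block r r' : (r + r' = t - 2)%N -> (r < r')%N -> (m r + m r' = n + n)%N ->
  dets 0%N 0%N twisted (row_class r ++ row_class r')
    (residue_class t n r.+1 ++ residue_class t n r'.+1)
  = (-1) ^+ ('C(n, 2) + 'C((m r').+1, 2)) * rs (quot r) (quot r').
Proof.
move=> er lr em; set a := m r; set b := m r'.
pose P1 := [seq q%:Z - b%:Z | q <- iota 0 n].
pose P2 := [seq q%:Z - b%:Z | q <- iota n n].
pose G (i : nat) (q : int) := if (i < a)%N then hsymz ((part (quot r) i)%:Z - i%:Z + q)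
     else hsymz ((part (quot r') (i - a))%:Z - (i - a)%:Z - 1 - q).
have -> : dets 0%N 0%N twisted (row_class r ++ row_class r')
    (residue_class t n r.+1 ++ residue_class t n r'.+1) =
    dets 0%N 0 G (iota 0 (a + b)) (rev P1 ++ P2).
  apply: eq_dets => [|i j]; first by rewrite size_cat !size_row_class size_iota.
  rewrite size_cat !size_row_class -/a -/b => li lj.
  have szP : size P1 = n by rewrite size_map size_iota.
  rewrite nth_iota // !nth_cat size_rev szP size_row_class size_residue_class /G add0n -/a.
  have rP j' : (j' < n)%N -> nth 0 (rev P1) j' = n%:Z - 1 - j'%:Z - b%:Z.
    move=> lj'; rewrite nth_rev szP // (nth_map 0%N) ?size_iota ?nth_iota; lia.
  have P2E j' : (j' < n)%N -> nth 0 P2 j' = n%:Z + j'%:Z - b%:Z.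
    by move=> lj'; rewrite (nth_map 0%N) ?size_iota // nth_iota.
  case: ltnP => ia; case: ltnP => jn.
  - rewrite nth_row_class // nth_residue_class // rP // twistedE; [|lia..].
    rewrite [X in if X then _ else _](_ : _ = false); last lia.
    by rewrite eqxx add0r; congr hsymz; rewrite -/a; lia.
  - rewrite nth_row_class // nth_residue_class ?P2E; [|lia..]; rewrite twistedE; [|lia..].
    rewrite [X in if X then _ else _](_ : _ = true); last lia.
    rewrite [r.+1 == _](_ : _ = false); last lia.
    rewrite [r.+1 == t](_ : _ = false); last lia.
    by rewrite addr0; congr hsymz; rewrite -/a; lia.
  - rewrite nth_row_class -/b; last lia.
    rewrite nth_residue_class // rP // twistedE; [|lia..].
    rewrite [X in if X then _ else _](_ : _ = true); last lia.
    rewrite [r'.+1 == _](_ : _ = false); last lia.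
    rewrite [r'.+1 == t](_ : _ = false); last lia.
    by rewrite addr0; congr hsymz; lia.
  - rewrite nth_row_class -/b; last lia.
    rewrite nth_residue_class ?P2E; [|lia..]; rewrite twistedE; [|lia..].
    rewrite [X in if X then _ else _](_ : _ = false); last lia.
    by rewrite eqxx add0r; congr hsymz; lia.
have sw := swaps_catr P2 (@swaps_rev symfun _ (rev P1)).
rewrite revK size_rev size_map size_iota in sw.
rewrite (swaps_cols _ _ _ sw); last by rewrite size_cat size_rev !size_map !size_iota.
rewrite -map_cat -{1}[n in iota n n]add0n -iotaD -em.
rewrite (rs_det (quot_part r) (quot_part r') (size_quot r) (size_quot r')).
rewrite mulrA -exprD -signr_odd -[in RHS]signr_odd; congr (_ ^+ nat_of_bool _ * _).
(* As a and b have the same parity, ab + C(b,2) has the parity of b + C(b,2) = C(b+1,2). *)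
have ab : odd a = odd b by have := congr1 odd em; rewrite -/a -/b !oddD; case: odd; case: odd; case: odd.
by rewrite binS bin1 !oddD oddM -/a -/b ab andbb; case: (odd b); rewrite ?addbT ?addbF ?addbN //= addbC.
Qed.

Lemma row_class_vanish r r' x y : (r <= t - 2)%N -> (r' <= t - 2)%N ->
  r' != r -> r' != (t - 2 - r)%N -> x \in row_class r -> y \in residue_class t n r'.+1 ->
  twisted x y = 0.
Proof.
move=> lr lr' n1 n2; rewrite mem_filter => /andP[/eqP xr _] /mapP[k _ ->].
rewrite (divn_eq x t) xr twistedE; [|lia..].
by rewrite !ifN ?addr0 //; lia.
Qed.

(** Rows and columns are sorted by residue, then the columns of residue 0 are moved to the end to
    face the rows of residue t - 1. With column class r + 1 facing row class r, [dets_peel] applies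
    with M = t - 2. *)
Lemma dets_twisted :
  (forall r, (r <= t - 2)%N -> (m r + m (t - 2 - r) = n + n)%N) -> m t.-1 = n ->
  dets 0%N 0%N twisted (beta N lam) (iota 0 N) =
  (-1) ^+ odd_perm (residue_sort t N lam) *
  (-1) ^+ ('C(n, 2) * 'C(t, 2) + n * t.-1 * n) *
  dets 0%N 0%N twisted (row_class t.-1) (residue_class t n 0) *
  ((-1) ^+ (\sum_(0 <= r < t.-1./2) n * t.-1 * (n + m (t - 2 - r))) *
   \prod_(0 <= r < t.-1./2)
     ((-1) ^+ ('C(n, 2) + 'C((m (t - r - 2)).+1, 2)) * rs (quot r) (quot (t - r - 2))) *
   (if odd t then 1 else so (quot (t - 2)./2))).
Proof.
move=> bal last; rewrite dets_beta -!mulrA; congr (_ * _).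
set rows := flatten _.
have szr l : size (flatten (map row_class (iota 0 l))) = (\sum_(0 <= r < l) m r)%N.
  rewrite size_flatten /shape -map_comp sumnE big_map /index_iota subn0.
  by apply: eq_bigr => r _; rewrite /= size_row_class.
have szrows : size rows = N by rewrite szr sum_mult.
rewrite (swaps_cols _ _ _ (swaps_residues symfun t n)) ?szrows ?size_iota //.
have iotaS : iota 0 t = 0%N :: map S (iota 0 t.-1).
  rewrite -{1}(prednK (_ : 0 < t)%N) /=; last lia.
  by rewrite -[1%N]addn0 iotaDl.
have szc l : size (flatten (map (fun r => residue_class t n r.+1) (iota 0 l))) = (n * l)%N.
  elim: l => [|l IH]; first by rewrite muln0.
  by rewrite -addn1 iotaD map_cat flatten_cat size_cat IH /= cats0 size_residue_class mulnDr muln1.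
rewrite iotaS /= -map_comp.
have sw := swaps_block symfun (residue_class t n 0)
  (flatten (map (fun r => residue_class t n r.+1) (iota 0 t.-1))).
rewrite szc size_residue_class in sw.
rewrite (swaps_cols _ _ _ sw); last first.
  by rewrite szrows size_cat szc size_residue_class -mulnS prednK; lia.
have rowsE : rows = flatten (map row_class (iota 0 t.-1)) ++ row_class t.-1.
  have -> : rows = flatten (map row_class (iota 0 t.-1 ++ [:: t.-1])).
    by rewrite -(iotaD 0 t.-1 1) addn1 prednK; last lia.
  by rewrite map_cat flatten_cat /= cats0.
have szr1 : size (flatten (map row_class (iota 0 t.-1))) = (n * t.-1)%N.
  have := szrows; rewrite rowsE size_cat size_row_class last => h; nia.
rewrite rowsE dets_cat_in; first last.
- move=> x y /flattenP[_ /mapP[r + ->]]; rewrite mem_iota mem_filter => lr /andP[/eqP xr _].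
  move=> /mapP[k _ ->]; rewrite (divn_eq x t) xr twistedE; [|lia..].
  by rewrite addn0 !ifN ?addr0 //; lia.
- by rewrite size_row_class size_residue_class.
- by rewrite szr1 szc.
rewrite (@dets_peel _ _ _ _ _ _ row_class (fun r => residue_class t n r.+1) n (t - 2)); first last.
- by move=> r r' x y h1 h2; apply: row_class_vanish; lia.
- by move=> r h; rewrite !size_row_class bal //; lia.
- by move=> r _; rewrite size_residue_class.
- lia.
rewrite !add0n [X in _ * X * _](_ : _ = \prod_(0 <= r < t.-1./2)
     ((-1) ^+ ('C(n, 2) + 'C((m (t - r - 2)).+1, 2)) * rs (quot r) (quot (t - r - 2)))); last first.
  apply: eq_big_nat => r lr; have -> : (t - r - 2 = t - 2 - r)%N by lia.
  by rewrite rs_block // ?bal //; lia.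
have -> : (if odd t.-1 then dets 0%N 0%N twisted (row_class t.-1./2)
      (residue_class t n t.-1./2.+1) else 1)
    = if odd t then 1 else so (quot (t - 2)./2).
  have -> : odd t.-1 = ~~ odd t by lia.
  case ot: (odd t) => //=.
  have -> : t.-1./2 = (t - 2)./2 by lia.
  have lp : ((t - 2)./2 <= t - 2)%N by lia.
  have := bal _ lp; rewrite (_ : (t - 2 - _)%N = (t - 2)./2); last lia.
  by move=> e; apply: so_block; [rewrite ot|lia].
under eq_bigr do rewrite size_row_class.
rewrite exprD -!mulrA; congr (_ * _); rewrite -(mulnC n); congr (_ * _).
by rewrite !mulrA mulrC !mulrA.
Qed.

End Twist.

(** * Comparison of the signs *)

Lemma sum_fold p (f : nat -> nat) :
  (\sum_(0 <= r < p.*2.+1) f r = \sum_(0 <= r < p) (f r + f (p.*2 - r)) + f p)%N.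
Proof.
rewrite (big_cat_nat (n := p)) //=; last lia.
rewrite (big_ltn (m := p)); last lia.
rewrite big_split /= -addnA; congr (_ + _)%N; rewrite addnC; congr (_ + _)%N.
rewrite big_nat_rev /= -{1}[p.+1]add0n big_addn (_ : p.*2.+1 - p.+1 = p)%N; last lia.
by apply: eq_big_nat => r lr; congr f; lia.
Qed.

(** With p the number of [rs] factors, C(t,2) has the parity of p for odd t, and the multiples of
    C(n,2) cancel. For even t it has the parity of p + 1: one C(n,2) survives and joins n to form
    C(n+1,2), while the sizes of the moved row classes yield n times the rank. *)
Lemma sign_parity t n (m : nat -> nat) : (1 < t)%N ->
  (forall r, (r <= t - 2)%N -> (m r + m (t - 2 - r) = n + n)%N) -> m t.-1 = n ->
  odd ('C(n, 2) * 'C(t, 2) + n * t.-1 * n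
       + \sum_(0 <= r < t.-1./2) n * t.-1 * (n + m (t - 2 - r))
       + \sum_(0 <= r < t.-1./2) ('C(n, 2) + 'C((m (t - r - 2)).+1, 2)))%N
  = odd (\sum_(t./2 <= r < t.-1) 'C((m r).+1, 2)
         + (if odd t then 0 else 'C(n.+1, 2) + n * \sum_(0 <= r < t) (m r - n)))%N.
Proof.
move=> t1 bal last.
have -> : (\sum_(t./2 <= r < t.-1) 'C((m r).+1, 2) =
    \sum_(0 <= r < t.-1./2) 'C((m (t - r - 2)).+1, 2))%N.
  rewrite big_nat_rev /= -{1}[t./2]add0n big_addn (_ : t.-1 - t./2 = t.-1./2)%N; last lia.
  by apply: eq_big_nat => r lr; congr ('C((m _).+1, 2)); lia.
set p := t.-1./2; rewrite [X in (_ + X)%N]big_split /= sum_nat_const_nat subn0.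
set S := (\sum_(0 <= r < p) 'C(_, _))%N; rewrite addnA oddD [RHS]oddD addbC; congr (_ (+) _).
have modd q : odd 'C(q.*2.+1, 2) = odd q.
  by rewrite bin2odd /= ?odd_double // doubleK oddM /= odd_double.
rewrite -big_distrr /= !(oddD, oddM).
case: ifP => ot.
  have -> : t = p.*2.+1 by rewrite /p; lia.
  rewrite modd /= odd_double !andbF /= addbF.
  by rewrite addbF andbC addbb.
have et : t = p.*2.+2 by rewrite /p; lia.
have -> : odd 'C(t, 2) = ~~ odd p.
  by rewrite et binS bin1 oddD modd /= odd_double addbT.
have -> : odd t.-1 by rewrite et /= odd_double.
(* Runner t - 1 and the self-paired runner p carry n beads each and contribute nothing to the
   rank. *)
have -> : (\sum_(0 <= r < t) (m r - n) = \sum_(0 <= r < p) ((m r - n) + (m (t - 2 - r) - n)))%N.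
  have e2 : (t - 2)%N = p.*2 by lia.
  have e1 : t.-1 = p.*2.+1 by lia.
  rewrite {1}et big_nat_recr //= -e1 last subnn addn0 e1 sum_fold.
  have lp : (p <= t - 2)%N by lia.
  have := bal p lp; rewrite e2 (_ : (p.*2 - p)%N = p) => [bp|]; last lia.
  by rewrite (_ : (m p - n)%N = 0%N) ?addn0 //; lia.
(* Since m_r + m_(t-2-r) = 2n, one truncated difference is 0 and the other is |m_(t-2-r) - n|, of
   the parity of n + m_(t-2-r). *)
have -> : odd (\sum_(0 <= r < p) (n + m (t - 2 - r)))%N =
    odd (\sum_(0 <= r < p) ((m r - n) + (m (t - 2 - r) - n)))%N.
  rewrite big_nat_cond [in RHS]big_nat_cond; elim/big_rec2: _ => // r x y lr e.
  have lp : (r <= t - 2)%N by lia.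
  by rewrite !oddD e; congr (_ (+) _); have := bal r lp; lia.
rewrite binS bin1 !(oddD, oddM).
by case: (odd 'C(n, 2)); case: (odd n); case: (odd p); case: (odd _).
Qed.

(* floor((t - 3) / 2) + 1 = (t - 1) / 2 is the number of rs factors *)
Theorem theorem3p3 (t n : nat) (lam : seq nat)
  (phi : {rmorphism symfun -> symfun}) :
  (2 <= t)%N -> (0 < n)%N ->
  is_part lam -> (size lam <= n * t)%N ->
  (forall r : nat, phi (hsym r) = if (t %| r)%N then hsym (r %/ t) else 0) ->
  (~~ part_symplectic (tcore t (n * t) lam) -> phi (sp lam) = 0)
  /\
  (part_symplectic (tcore t (n * t) lam) ->
   phi (sp lam) =
     (-1) ^+ eps_sp t n lam
     * (-1) ^+ odd_perm (residue_sort t (n * t) lam)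
     * sp (tquot t (n * t) lam t.-1)
     * (\prod_(0 <= r < t.-1./2)
          rs (tquot t (n * t) lam r) (tquot t (n * t) lam (t - r - 2)))
     * (if odd t then 1 else so (tquot t (n * t) lam (t - 2)./2))).
Proof.
move=> t1 n0 lp ls phih; have sm := sum_mult t1 n0 lp ls.
have core := symplectic_core t1 n0 sm; rewrite (phi_sp phi t1 n0 lp ls); split=> [ns|].
  apply/eqP; rewrite scaler_eq0; apply/orP; right; apply: contraNT ns => nz.
  by apply/core; apply: twisted_balanced nz.
move=> /core[bal last]; rewrite (dets_twisted t1 n0 lp ls phih bal last).
set d0 := dets _ _ _ _ _; set P := (-1) ^+ _ * \prod_(_ <= _ < _) _ * _.
(* The scalar 1/2 goes to the block of residue t - 1, the one that becomes [sp]. *)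
have -> a b : 2%:R^-1 *: (a * b * d0 * P) = a * b * (2%:R^-1 *: d0) * P :> symfun.
  by rewrite [_ * d0]mulrC [_ * (_ *: _)]mulrC -!scalerAl.
rewrite (sp_block t1 n0 lp ls phih last) /P big_split /= -expr_sum.
have -> : (-1) ^+ eps_sp t n lam = (-1) ^+ ('C(n, 2) * 'C(t, 2) + n * t.-1 * n
    + \sum_(0 <= r < t.-1./2) n * t.-1 * (n + beta_mult t (n * t) lam (t - 2 - r))
    + \sum_(0 <= r < t.-1./2) ('C(n, 2) + 'C((beta_mult t (n * t) lam (t - r - 2)).+1, 2)))
    :> symfun.
  rewrite -signr_odd -[RHS]signr_odd (sign_parity t1 bal last) /eps_sp.
  by rewrite [frob_rank _](frob_rank_core t1 n0 sm).
rewrite 2![in RHS]exprD.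
move: ((-1) ^+ residue_sort _ _ _) (sp _) (\prod_(_ <= _ < _) _) => sw s0 P0.
move: (if _ then _ else _) ((-1) ^+ _) ((-1) ^+ (\sum_(_ <= _ < _) _ * _)) => D e1 e2.
move: ((-1) ^+ _) => e3; ring.
Qed.
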